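(* Let $(M^n,g)$ be a complete noncompact $n$-dimensional Riemannian manifold, $u\in C^\infty(M)$, $V=e^u$, $\lambda,\mu\in\mathbb{R}$, $D=D^{\lambda,\mu}$, and $\tau=(n+1)\lambda+\mu$. Let $\rho$ and $a$ be nonnegative functions on $M$ such that $|\nabla^D\rho|=1$, $\Delta^D\rho\ge\frac{C}{\rho}V^{\lambda-\mu}$ and $\langle\nabla^D\rho,\nabla^Da\rangle\ge0$ in the sense of distributions, where $C>1$, $C+\alpha+1>0$ and $\alpha\in\mathbb{R}$. Then for every $\phi\in C_0^\infty(M\setminus\rho^{-1}\{0\})$ and $1<p<+\infty$, $$\int_Ma\rho^{\alpha+p}|\langle\nabla^D\rho,\nabla^D\phi\rangle|^pV^{\tau+\lambda-\mu}\,dv_g\ \ge\ \left(\frac{C+\alpha+1}{p}\right)^p\int_Ma\rho^\alpha|\phi|^pV^{\tau+\lambda-\mu}\,dv_g+\left(\frac{C+\alpha+1}{p}\right)^{p-1}\int_M\rho^{\alpha+1}|\phi|^p\langle\nabla^D\rho,\nabla^Da\rangle V^{\tau+\lambda-\mu}\,dv_g.$$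
   Context: $\nabla$, $\Delta=\mathrm{div}\,\nabla$, $dv_g$ denote the Levi-Civita connection/gradient, Laplacian and Riemannian volume of $g$; $\langle\cdot,\cdot\rangle=g$ and $|\cdot|$ is the norm of $g$. The affine connection $D=D^{\lambda,\mu}$ is $D_XY=\nabla_XY+\lambda\,du(X)Y+\lambda\,du(Y)X+\mu\,g(X,Y)\nabla u$. The affine gradient of a function $f$ is $\nabla^Df=V^{\mu-\lambda}\nabla f$. The affine Laplacian is $\Delta^Df=V^{\mu-\lambda}\left[\Delta f+(2\mu+n\lambda)\langle\nabla u,\nabla f\rangle\right]$; equivalently $V^\tau\Delta^Df=\mathrm{div}(V^\tau\nabla^Df)$. Distributional conditions: ''$|\nabla^D\rho|=1$ in the sense of distributions'' means that $\rho$ is locally Lipschitz and its (weak) gradient satisfies $|\nabla^D\rho|=1$ almost everywhere. ''$\Delta^D\rho\ge\frac{C}{\rho}V^{\lambda-\mu}$ in the sense of distributions'' means that $-\int_M\langle\nabla\psi,\nabla^D\rho\rangle V^\tau\,dv_g\ge\int_M\frac{C}{\rho}\psi V^{\tau+\lambda-\mu}\,dv_g$ for all nonnegative compactly supported Lipschitz $\psi$ with support in $M\setminus\rho^{-1}\{0\}$. The function $a$ is locally Lipschitz and $\langle\nabla^D\rho,\nabla^Da\rangle\ge0$ holds almost everywhere. *)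

(* Defs.v *)
From HB Require Import structures.
From mathcomp Require Export all_boot all_order all_algebra.
From mathcomp Require Export all_classical all_reals all_analysis.
Export Order.TTheory GRing.Theory Num.Theory numFieldNormedType.Exports.

Set Implicit Arguments.
Unset Strict Implicit.
Unset Printing Implicit Defensive.

Local Open Scope classical_set_scope.
Local Open Scope ring_scope.

Section Smoothness.
Context {R : realType}.

(* For k >= 1, being C^k on an open set amounts to being differentiable with
   all directional derivatives C^(k-1). *)
Fixpoint Ck_on (k : nat) (E F : normedModType R) (U : set E) (f : E -> F)
    : Prop :=
  match k with
  | 0 => forall x, U x -> {for x, continuous f}
  | k'.+1 => (forall x, U x -> differentiable f x) /\
             (forall v, Ck_on k' U (fun x => 'D_v f x))
  end.

Definition smooth_on (E F : normedModType R) (U : set E) (f : E -> F) : Prop :=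
  forall k, Ck_on k U f.

End Smoothness.

Section Manifolds.
Context {R : realType}.

Record chart (n : nat) (M : topologicalType) := Chart {
  cdom : set M;
  ccod : set 'rV[R]_n;
  cmap : M -> 'rV[R]_n;
  cinv : 'rV[R]_n -> M;
  cdom_open : open cdom;
  ccod_open : open ccod;
  cmap_fun : forall x, cdom x -> ccod (cmap x);
  cinv_fun : forall y, ccod y -> cdom (cinv y);
  cmapK : forall x, cdom x -> cinv (cmap x) = x;
  cinvK : forall y, ccod y -> cmap (cinv y) = y;
  cmap_continuous : forall x, cdom x -> {for x, continuous cmap};
  cinv_continuous : forall y, ccod y -> {for y, continuous cinv} }.

(* The carrier is pointed (so nonempty) only because measurable types are.
   [chart_at x] is a preferred chart around x: its coordinates are used to
   identify the tangent space at x with 'rV[R]_n. *)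
Record smooth_manifold (n : nat) := SmoothManifold {
  carrier :> ptopologicalType;
  carrier_hausdorff : hausdorff_space carrier;
  carrier_second_countable : @second_countable carrier;
  atlas : set (chart n carrier);
  chart_at : carrier -> chart n carrier;
  chart_at_atlas : forall x, atlas (chart_at x);
  chart_at_dom : forall x, cdom (chart_at x) x;
  atlas_compatible : forall c c', atlas c -> atlas c' ->
    smooth_on (ccod c `&` cinv c @^-1` cdom c') (cmap c' \o cinv c) }.

Definition smooth_fun (n : nat) (M : smooth_manifold n) (f : M -> R) : Prop :=
  forall c : chart n M, atlas c -> smooth_on (ccod c) (f \o cinv c).

(* A family of bilinear forms on the tangent spaces, read in the chart c:
   the Jacobian J maps c-coordinates of a tangent (row) vector at cinv c y to
   its coordinates in the preferred chart of that point. *)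
Definition form_in_chart (n : nat) (M : smooth_manifold n)
    (g : M -> 'M[R]_n) (c : chart n M) (y : 'rV[R]_n) : 'M[R]_n :=
  let x := cinv c y in
  let J := jacobian (cmap (chart_at x) \o cinv c) y in
  J *m g x *m J^T.

Record riemannian_metric (n : nat) (M : smooth_manifold n) := RiemannianMetric {
  metric_mx :> M -> 'M[R]_n;
  metric_sym : forall x, (metric_mx x)^T = metric_mx x;
  metric_pos : forall x (v : 'rV[R]_n), v != 0 ->
    0 < (v *m metric_mx x *m v^T) 0 0;
  metric_smooth : forall c : chart n M, atlas c ->
    smooth_on (ccod c) (form_in_chart metric_mx c) }.

End Manifolds.

Section RiemannianGeometry.
Context {R : realType} {n : nat} {M : @smooth_manifold R n}.
Variable g : riemannian_metric M.

Definition inner (x : M) (v w : 'rV[R]_n) : R := (v *m g x *m w^T) 0 0.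

Definition tnorm (x : M) (v : 'rV[R]_n) : R := Num.sqrt (inner x v v).

Definition smooth_curve (c : R -> M) (a b : R) : Prop :=
  forall t, a <= t <= b -> {for t, continuous c} /\
    exists2 U : set R, open_nbhs t U & smooth_on U (cmap (chart_at (c t)) \o c).

Definition velocity (c : R -> M) (t : R) : 'rV[R]_n :=
  derive1 (cmap (chart_at (c t)) \o c) t.

Definition curve_length (c : R -> M) (a b : R) : \bar R :=
  (\int[lebesgue_measure]_(t in `[a, b]) (tnorm (c t) (velocity c t))%:E)%E.

(* [joined x y l]: some piecewise smooth curve from x to y has length l. *)
Inductive joined (x : M) : M -> \bar R -> Prop :=
| joined_refl : joined x x 0%E
| joined_step (y : M) (l : \bar R) (c : R -> M) (a b : R) :
    joined x y l -> a <= b -> smooth_curve c a b -> c a = y ->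
    joined x (c b) (l + curve_length c a b)%E.

(* +oo between distinct connected components *)
Definition riem_dist (x y : M) : \bar R := ereal_inf [set l | joined x y l].

Definition riem_complete : Prop :=
  forall s : nat -> M,
    (forall e : R, 0 < e -> exists N, forall i j, (N <= i)%N -> (N <= j)%N ->
       (riem_dist (s i) (s j) < e%:E)%E) ->
    exists x, forall e : R, 0 < e -> exists N, forall i, (N <= i)%N ->
       (riem_dist (s i) x < e%:E)%E.

Definition lipschitz_in (U : set M) (f : M -> R) : Prop :=
  exists2 K : R, 0 < K & forall x y, U x -> U y ->
    (`|f x - f y|%:E <= K%:E * riem_dist x y)%E.

Definition locally_lipschitz (f : M -> R) : Prop :=
  forall x : M, exists2 U : set M, nbhs (x : carrier M) U & lipschitz_in U f.

Definition differentiable_at (f : M -> R) (x : M) : Prop :=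
  differentiable (f \o cinv (chart_at x)) (cmap (chart_at x) x).

(* Raises the index of the differential; meaningful where f is
   differentiable. *)
Definition grad (f : M -> R) (x : M) : 'rV[R]_n :=
  (\row_i 'D_(delta_mx 0 i) (f \o cinv (chart_at x)) (cmap (chart_at x) x))
    *m invmx (g x).

Definition support (f : M -> R) : set M := closure [set x | f x != 0].

Definition compactly_supported_in (f : M -> R) (U : set M) : Prop :=
  compact (support f) /\ support f `<=` U.

End RiemannianGeometry.

Notation borel M := (g_sigma_algebraType (@open M)).

Section Volume.
Context {R : realType}.

(* Lebesgue integral over R^n of a nonnegative Borel function, as an iterated
   integral (Tonelli). *)
Fixpoint integral_rV (n : nat) : ('rV[R]_n -> \bar R) -> \bar R :=
  match n with
  | 0 => fun f => f 0
  | m.+1 => fun f => (\int[lebesgue_measure]_t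
      integral_rV (fun y : 'rV[R]_m => f (row_mx (t%:M : 'rV[R]_1) y)))%E
  end.

(* As M is second countable, these conditions determine the measure. *)
Definition is_riemannian_volume (n : nat) (M : @smooth_manifold R n)
    (g : riemannian_metric M) (vol : {measure set (borel M) -> \bar R}) : Prop :=
  forall c : chart n M, atlas c ->
  forall A : set (borel M), measurable A -> A `<=` cdom c ->
    vol A = integral_rV (fun y => (\1_(ccod c `&` cinv c @^-1` A) y *
                                   Num.sqrt (\det (form_in_chart g c y)))%:E).

End Volume.

Section AffineConnection.
Context {R : realType} {n : nat} {M : @smooth_manifold R n}.
Variables (g : riemannian_metric M) (vol : {measure set (borel M) -> \bar R}).
Variables (u : M -> R) (lam mu : R).

Definition Vfun (x : M) : R := expR (u x).

Definition tau : R := n.+1%:R * lam + mu.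

Definition agrad (f : M -> R) (x : M) : 'rV[R]_n :=
  Vfun x `^ (mu - lam) *: grad g f x.

(* In the two definitions below the gradients are the almost everywhere
   defined (Rademacher) gradients of locally Lipschitz functions, which are
   their weak gradients. *)
Definition unit_agrad (rho : M -> R) : Prop :=
  locally_lipschitz g rho /\
  {ae vol, forall x : borel M,
     differentiable_at rho x /\ tnorm g x (agrad rho x) = 1}.

Definition agrad_inner_ge0 (rho a : M -> R) : Prop :=
  locally_lipschitz g a /\
  {ae vol, forall x : borel M,
     [/\ differentiable_at rho x, differentiable_at a x &
         0 <= inner g x (agrad rho x) (agrad a x)]}.

(* Delta^D rho >= C / rho * V^(lam - mu) in the sense of distributions *)
Definition alaplacian_ge (rho : M -> R) (C : R) : Prop :=
  forall psi : M -> R, (forall x, 0 <= psi x) -> lipschitz_in g setT psi ->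
    compactly_supported_in psi (~` (rho @^-1` [set 0])) ->
    (\int[vol]_x (C / rho x * psi x * Vfun x `^ (tau + lam - mu))%:E <=
     - \int[vol]_x
         (inner g x (grad g psi x) (agrad rho x) * Vfun x `^ tau)%:E)%E.

End AffineConnection.

Arguments tau {R} n lam mu.

(* Main.v *)
Require Import Defs.
From mathcomp Require Import measurable_realfun lra ring.

(** Test the weak inequality for rho with psi = a rho^(alpha+1) |phi|^p, which
    is Lipschitz with compact support away from the zeros of rho. Expanding
    its gradient, the term in phi is p a rho^(alpha+1) |phi|^(p-1) sgn(phi)
    <nablaD rho, nablaD phi>; Young's inequality with K = (C+alpha+1)/p
    absorbs it pointwise into (p-1) K^p A + L, where A and L are the integrands
    of the first right-hand and of the left-hand integral, and integration
    gives the result.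
    Two points need care: psi must be globally Lipschitz for the distance given
    by lengths of curves, and the integrands, whose gradients are read in
    arbitrarily chosen charts, are measurable only off a null set. *)

Set Implicit Arguments.
Unset Strict Implicit.
Unset Printing Implicit Defensive.

Local Open Scope classical_set_scope.
Local Open Scope ring_scope.

(** * Lower integrals of nonmeasurable functions *)

(** The constant comes from an optimization. Young's inequality with a free parameter K, after the
    weak inequality is multiplied by K^(p-1), leaves the coefficient (C+alpha+1) K^(p-1) - (p-1) K^p
    in front of the integral of A; it is largest at K = (C+alpha+1)/p, where it equals K^p. The term
    with <nablaD rho, nablaD a> is nonnegative on the good set but has no integrability known in
    advance: no bound of a gradient by a local Lipschitz constant is established. Its integrability
    is extracted from the weak inequality itself, whose left side is finite. Since [vol] is a Borel
    measure, agreement off a null set does not give measurability. For an arbitrary nonnegative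
    function the integral is a supremum over simple functions below it, so it is monotone and
    superadditive, and insensitive to null sets. This is enough to move every integral to a set E,
    the support of [phi] minus one null set, on which all integrands are measurable; it also handles
    curve lengths, whose integrand is arbitrary. *)

Section LowerIntegral.
Context d (T : measurableType d) (R : realType) (mu : {measure set T -> \bar R}).
Local Open Scope ereal_scope.
Implicit Types (f g : T -> \bar R) (D N : set T).
Import HBNNSimple.

Lemma ge0_le_integral_nonmeasurable D f g :
  (forall x, D x -> 0 <= f x) -> (forall x, D x -> f x <= g x) ->
  \int[mu]_(x in D) f x <= \int[mu]_(x in D) g x.
Proof.
move=> f0 fg; rewrite !(integral_mkcond D).
have h0 x : 0 <= (f \_ D) x by apply: erestrict_ge0.
have hk x : (f \_ D) x <= (g \_ D) x by apply: lee_restrict.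
rewrite !ge0_integralTE//; last by move=> x; exact: le_trans (h0 x) (hk x).
apply: le_ereal_sup => _ [h hf <-]; exists h => // x.
exact: le_trans (hf x) (hk x).
Qed.

(* The integral of a nonmeasurable nonnegative function is a lower integral,
   hence only superadditive. *)
Lemma ge0_integralD_ge f g : (forall x, 0 <= f x) -> (forall x, 0 <= g x) ->
  \int[mu]_x f x + \int[mu]_x g x <= \int[mu]_x (f x + g x).
Proof.
move=> f0 g0.
have fg0 x : 0 <= f x + g x by exact: adde_ge0.
rewrite !ge0_integralTE//.
set F := [set _ | _ in _]; set G := [set _ | _ in _]; set H := [set _ | _ in _].
have F0 : 0 <= ereal_sup F.
  by apply: ereal_sup_ubound; exists nnsfun0 => //; exact: sintegral0.
have G0 : 0 <= ereal_sup G.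
  by apply: ereal_sup_ubound; exists nnsfun0 => //; exact: sintegral0.
(* An infinite right side is immediate. A finite one bounds both suprema, so subtraction in [\bar R]
   is safe and the two suprema can be treated one after the other. *)
rewrite addeC; have [->|Hy] := eqVneq (ereal_sup H) +oo; first by rewrite leey.
have key h k : F h -> G k -> h + k <= ereal_sup H.
  move=> [h' hf <-] [k' kg <-]; rewrite -sintegralD//; apply: ereal_sup_ubound.
  exists (add_nnsfun h' k') => //= x; rewrite EFinD; exact: leeD.
have F00 : F 0 by exists nnsfun0 => //; exact: sintegral0.
have G00 : G 0 by exists nnsfun0 => //; exact: sintegral0.
have GH : ereal_sup G <= ereal_sup H.
  by apply: ge_ereal_sup => k Gk; rewrite -[k]add0e; exact: key.
have Gfin : ereal_sup G \is a fin_num.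
  rewrite ge0_fin_numE//; apply: le_lt_trans GH _; rewrite ltey//.
rewrite addeC -leeBrDr//; apply: ge_ereal_sup => h Fh.
rewrite leeBrDr// addeC.
have h0 : 0 <= h by case: Fh => h' _ <-; exact: sintegral_ge0.
have hfin : h \is a fin_num.
  rewrite ge0_fin_numE//; apply: le_lt_trans (_ : _ <= ereal_sup H) _; last by rewrite ltey.
  by rewrite -[h]adde0; exact: key.
rewrite -leeBrDr//; apply: ge_ereal_sup => k Gk.
by rewrite leeBrDr// addeC; exact: key.
Qed.

(** Null-set lemmas for measurable functions are applied to the simple functions below [f], not to
    [f]: multiplying such a function by the indicator of the complement of [N] keeps its integral
    and puts it below [f] restricted to [D] minus [N]. *)
Lemma ge0_integral_setD_null D N f : measurable N -> mu N = 0 ->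
  (forall x, D x -> 0 <= f x) ->
  \int[mu]_(x in D) f x = \int[mu]_(x in D `\` N) f x.
Proof.
move=> mN N0 f0; apply/eqP; rewrite eq_le; apply/andP; split; last first.
  rewrite !(integral_mkcond (D `\` N)) (integral_mkcond D).
  apply: ge0_le_integral_nonmeasurable => x _.
    by apply: erestrict_ge0 => y [Dy _]; exact: f0.
  rewrite /patch; case: ifPn => [|_]; first by rewrite inE => -[Dx _]; rewrite mem_set.
  by case: ifPn => //; rewrite inE => /f0.
rewrite !(integral_mkcond D) (integral_mkcond (D `\` N)).
rewrite !ge0_integralTE//; last 2 first.
- by apply: erestrict_ge0 => y [Dy _]; exact: f0.
- exact: erestrict_ge0.
apply: ge_ereal_sup => _ [h hf <-].
pose k := proj_nnsfun h (measurableC mN).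
apply: (@le_trans _ _ (sintegral mu k)).
  rewrite -!integralT_nnsfun.
  rewrite (ge0_negligible_integral mN measurableT _ _ N0)//; last first.
    by move=> x _; rewrite lee_fin.
    exact/measurable_EFinP/measurable_funTS.
  rewrite [leRHS](ge0_negligible_integral mN measurableT _ _ N0)//; last first.
    by move=> x _; rewrite lee_fin.
    exact/measurable_EFinP/measurable_funTS.
  rewrite le_eqVlt; apply/orP; left; apply/eqP/eq_integral => x.
  by rewrite inE => -[_ Nx]; rewrite /= mindicE mem_set//= mulr1.
apply: ereal_sup_ubound; exists k => // x; rewrite /= mindicE.
have [Nx|Nx] := boolP (x \in ~` N); last first.
  rewrite mulr0; apply: erestrict_ge0 => y [Dy _]; exact: f0.
rewrite mulr1 (le_trans (hf x))// /patch.
case: ifPn => // Dx; last by case: ifPn => //; rewrite inE => -[/mem_set]; rewrite (negbTE Dx).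
by rewrite ifT//; rewrite inE; split; exact/set_mem.
Qed.

Lemma integral_setD_null D N f : measurable N -> mu N = 0 ->
  \int[mu]_(x in D) f x = \int[mu]_(x in D `\` N) f x.
Proof.
move=> mN N0; rewrite integralE [RHS]integralE.
by congr (_ - _); apply: ge0_integral_setD_null.
Qed.

End LowerIntegral.

(** * Gradients in charts *)

Section Partials.
Context {R : realType} {n : nat}.

Definition partials (f : 'rV[R]_n -> R) (y : 'rV[R]_n) : 'rV[R]_n :=
  \row_i 'D_(delta_mx 0 i) f y.

Lemma near_eq_partials (f h : 'rV[R]_n -> R) y :
  (\near y, f y = h y) -> partials f y = partials h y.
Proof. by move=> fh; apply/rowP => i; rewrite !mxE; exact: near_eq_derive. Qed.

(** Vectors are rows and the Jacobian acts on them from the right, so covectors, also stored as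
    rows, transform by its transpose. *)
Lemma partials_comp (f : 'rV[R]_n -> R) (T : 'rV[R]_n -> 'rV[R]_n) y :
  differentiable T y -> differentiable f (T y) ->
  partials (f \o T) y = partials f (T y) *m (jacobian T y)^T.
Proof.
move=> dT df; apply/rowP => i; rewrite !mxE.
rewrite deriveE; last exact: differentiable_comp.
rewrite diff_comp//=.
have -> : 'd T y (delta_mx 0 i) = delta_mx 0 i *m jacobian T y.
  by rewrite /jacobian mul_rV_lin1.
rewrite -rowE [X in 'd f _ X]row_sum_delta linear_sum/=.
apply: eq_bigr => j _; rewrite linearZ/= !mxE (deriveE _ df).
by rewrite mulrC.
Qed.

Lemma diff_partials (f : 'rV[R]_n -> R) y v : differentiable f y ->
  'D_v f y = (v *m (partials f y)^T) 0 0.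
Proof.
move=> df; rewrite deriveE// [X in 'd f _ X]row_sum_delta linear_sum !mxE/=.
by apply: eq_bigr => j _; rewrite linearZ/= !mxE -deriveE.
Qed.

Lemma jacobian_left_inverse (T S : 'rV[R]_n -> 'rV[R]_n) y :
  differentiable T y -> differentiable S (T y) ->
  (\near y, S (T y) = y) -> jacobian T y *m jacobian S (T y) = 1%:M.
Proof.
move=> dT dS TS; apply/row_matrixP => i; rewrite !rowE mulmxA mulmx1.
rewrite -deriveEjacobian// -deriveEjacobian// deriveE// deriveE//.
rewrite -['d S _ _]/(('d S (T y) \o 'd T y) _) -diff_comp// -deriveE.
  by rewrite (near_eq_derive _ (g := id))// derive_id.
exact: differentiable_comp.
Qed.

End Partials.

Lemma invmx_mul (F : fieldType) n (A B : 'M[F]_n) :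
  A \in unitmx -> B \in unitmx -> invmx (A *m B) = invmx B *m invmx A.
Proof.
move=> uA uB; have uAB : A *m B \in unitmx by rewrite unitmx_mul uA.
apply: (can_inj (mulmxK uAB)).
by rewrite mulVmx// mulmxA mulmxKV// mulVmx.
Qed.

Section ChartCalculus.
Context {R : realType} {n : nat} {M : @smooth_manifold R n}.
Variable g : riemannian_metric M.
Implicit Types (c : @chart R n M) (f h : M -> R) (x : M).

(** [grad] reads each point in its own preferred chart, and this choice may vary wildly from point
    to point. Measurability and continuity arguments need the partial derivatives in one fixed
    chart, as functions of the point of [M]. *)
Definition chart_partials c f (x : M) : 'rV[R]_n :=
  partials (f \o cinv c) (cmap c x).

Lemma gradE f x : grad g f x = chart_partials (chart_at x) f x *m invmx (g x).
Proof. by []. Qed.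

Lemma metric_unit x : (g x : 'M[R]_n) \in unitmx.
Proof.
rewrite unitmxE unitfE; apply/det0P => -[v v0 vg].
by have := metric_pos g x v0; rewrite vg mul0mx mxE ltxx.
Qed.

Lemma inner_grad f h x : inner g x (grad g f x) (grad g h x) =
  (chart_partials (chart_at x) f x *m invmx (g x) *m
    (chart_partials (chart_at x) h x)^T) 0 0.
Proof.
by rewrite /inner !gradE mulmxKV ?metric_unit// trmx_mul trmx_inv metric_sym mulmxA.
Qed.

Lemma near_chart c x : cdom c x ->
  \forall y \near cmap c x, ccod c y.
Proof. by move=> cx; apply: open_nbhs_nbhs; split; [exact: ccod_open|exact: cmap_fun]. Qed.

Lemma near_chart_inv c x (P : set M) : cdom c x -> nbhs x P ->
  \forall y \near cmap c x, P (cinv c y).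
Proof.
move=> cx Px; have := cinv_continuous (cmap_fun cx).
by move/(_ P); apply; rewrite cmapK.
Qed.

Lemma near_chart_dom c x : cdom c x -> nbhs x (cdom c).
Proof. by move=> cx; apply: open_nbhs_nbhs; split => //; exact: cdom_open. Qed.

Definition transition c c' : 'rV[R]_n -> 'rV[R]_n := cmap c' \o cinv c.

Lemma transition_differentiable c c' x : atlas c -> atlas c' ->
  cdom c x -> cdom c' x -> differentiable (transition c c') (cmap c x).
Proof.
move=> ac ac' cx c'x; have [+ _] := atlas_compatible ac ac' 1; apply.
by split; [exact: cmap_fun|rewrite /preimage/= cmapK].
Qed.

Lemma transitionE c c' x : cdom c x -> transition c c' (cmap c x) = cmap c' x.
Proof. by move=> cx; rewrite /transition/= cmapK. Qed.

Lemma transitionK c c' x : atlas c -> atlas c' -> cdom c x -> cdom c' x ->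
  \forall y \near cmap c x, transition c' c (transition c c' y) = y.
Proof.
move=> ac ac' cx c'x; near=> y; rewrite /transition/= cmapK ?cinvK//.
  near: y; exact: near_chart.
near: y; apply: near_chart_inv => //; exact: near_chart_dom.
Unshelve. all: by end_near. Qed.

Lemma jacobian_transitionK c c' x : atlas c -> atlas c' -> cdom c x -> cdom c' x ->
  jacobian (transition c c') (cmap c x) *m jacobian (transition c' c) (cmap c' x)
    = 1%:M.
Proof.
move=> ac ac' cx c'x; rewrite -(transitionE c' cx) jacobian_left_inverse//.
- exact: transition_differentiable.
- by rewrite transitionE//; exact: transition_differentiable.
- exact: transitionK.
Qed.




Lemma chart_partials_change c f x : atlas c -> cdom c x -> differentiable_at f x ->
  chart_partials c f x = chart_partials (chart_at x) f x *m
    (jacobian (transition c (chart_at x)) (cmap c x))^T.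
Proof.
move=> ac cx dfx; have ax := chart_at_atlas x; have dx := chart_at_dom x.
rewrite /chart_partials -[in RHS](transitionE (chart_at x) cx) -partials_comp.
- apply: near_eq_partials; near=> y; rewrite /transition/= cmapK//.
  near: y; apply: near_chart_inv => //; exact: near_chart_dom.
- exact: transition_differentiable.
- by rewrite transitionE.
Unshelve. all: by end_near. Qed.

(** The transposed Jacobians produced by the two covectors cancel against the inverse of J g J^T.
    The product is thus independent of the chart, which removes the arbitrary choice of preferred
    charts. *)
Lemma inner_grad_chart c f h x : atlas c -> cdom c x ->
  differentiable_at f x -> differentiable_at h x ->
  inner g x (grad g f x) (grad g h x) =
  (chart_partials c f x *m invmx (form_in_chart g c (cmap c x)) *m
    (chart_partials c h x)^T) 0 0.
Proof.
move=> ac cx df dh; have ax := chart_at_atlas x; have dx := chart_at_dom x.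
rewrite inner_grad !(chart_partials_change ac cx)// /form_in_chart cmapK//.
rewrite -/(transition c (chart_at x)).
have JK := jacobian_transitionK ac ax cx dx.
set J := jacobian _ _ in JK *; set J' := jacobian _ _ in JK.
have [JU _] := mulmx1_unit JK.
have JTU : J^T \in unitmx by rewrite unitmx_tr.
rewrite trmx_mul trmxK !invmx_mul ?unitmx_mul ?JU ?metric_unit//.
by rewrite !mulmxA mulmxK// mulmxKV.
Qed.

End ChartCalculus.

(** * Measurability of gradients *)

Section MatrixLimits.
Context {R : realType} {T : Type} (F : set_system T) {FF : Filter F}.

Lemma cvg_det m (A : T -> 'M[R]_m) (B : 'M[R]_m) :
  (forall i j, A x i j @[x --> F] --> B i j) ->
  \det (A x) @[x --> F] --> \det B.
Proof.
move=> AB; apply: cvg_big => [|s _]; first exact: add_continuous.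
apply: cvgMl_tmp; apply: cvg_big => [|i _]; first exact: mul_continuous.
exact: AB.
Qed.

(** Cramer's rule: entries of the inverse are cofactors over the determinant. Invertibility near the
    limit is assumed because [invmx] returns its argument on singular matrices. *)
Lemma cvg_invmx m (A : T -> 'M[R]_m) (B : 'M[R]_m) :
  (forall i j, A x i j @[x --> F] --> B i j) ->
  B \in unitmx -> (\forall x \near F, A x \in unitmx) ->
  forall i j, (invmx (A x)) i j @[x --> F] --> (invmx B) i j.
Proof.
move=> AB uB uA i j; rewrite /invmx uB !mxE.
apply: (@cvg_trans _ ((fun x => (\det (A x))^-1 * cofactor (A x) j i) @ F)).
  apply: near_eq_cvg; near=> x; rewrite ifT ?mxE//; near: x; exact: uA.
apply: cvgM.
  by apply: cvgV; [rewrite -unitfE -unitmxE|exact: cvg_det].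
apply: cvgMl_tmp; apply: cvg_det => k l; under eq_fun do rewrite !mxE.
by rewrite !mxE; exact: AB.
Unshelve. all: by end_near. Qed.

End MatrixLimits.

Lemma measurable_continuous_open {R : realType} (T : ptopologicalType) (U : set T) (f : T -> R) :
  open U -> (forall x, U x -> {for x, continuous f}) ->
  measurable_fun (U : set (borel T)) (f : borel T -> R).
Proof.
move=> oU cf; apply: (measurability _ (RGenOInfty.measurableE R)).
move=> _ [_ [r ->] <-]; apply: sub_sigma_algebra; rewrite /= openE => x [Ux fx].
apply: filterI; first exact: open_nbhs_nbhs.
by apply: cf => //; apply: open_nbhs_nbhs; split => //; exact: interval_open.
Qed.

(** The sets [A] with [P (K \ A)] form a filter, proper if [P K] fails. A cluster point in [K] has a
    neighbourhood [U] satisfying [P], so the complement of [U] belongs to the filter, contradicting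
    the clustering. *)
Lemma compact_ind (T : topologicalType) (K : set T) (P : set T -> Prop) :
  compact K -> P set0 -> (forall A B, P A -> P B -> P (A `|` B)) ->
  (forall A B, A `<=` B -> P B -> P A) ->
  (forall x, K x -> exists2 U, nbhs x U & P U) -> P K.
Proof.
move=> cK P0 PU PS PK; apply: contrapT => nPK.
pose F := [set A | P (K `\` A)].
have FF : Filter F.
  split; rewrite /F/=.
  - by rewrite setDT.
  - move=> A B FA FB; rewrite /mkset setDIr; exact: PU.
  - move=> A B AB; apply: PS; exact: setDS.
have PF : ProperFilter F.
  by apply: Build_ProperFilter; rewrite /F/= setD0.
have FK : F K by rewrite /F/= setDv.
have [x [Kx clx]] := cK F PF FK.
have [U xU PUx] := PK x Kx.
have FU : F (~` U) by apply: PS PUx => y [_ /contrapT].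
by have [y []] := clx _ _ FU xU.
Qed.

Section ChartMeasurability.
Context {R : realType} {n : nat} {M : @smooth_manifold R n}.
Variable g : riemannian_metric M.
Implicit Types (c : @chart R n M) (f h : M -> R) (x : M).

Lemma form_in_chart_unit c x : atlas c -> cdom c x ->
  form_in_chart g c (cmap c x) \in unitmx.
Proof.
move=> ac cx; rewrite /form_in_chart cmapK// -/(transition c (chart_at x)).
have JK := jacobian_transitionK ac (chart_at_atlas x) cx (chart_at_dom x).
by have [JU _] := mulmx1_unit JK; rewrite !unitmx_mul unitmx_tr JU metric_unit.
Qed.

Lemma form_in_chart_continuous c x i j : atlas c -> cdom c x ->
  {for x, continuous (fun x => form_in_chart g c (cmap c x) i j)}.
Proof.
move=> ac cx.
have := metric_smooth g ac 0 _ (cmap_fun cx).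
move=> /(continuous_comp (cmap_continuous cx)) fc.
apply: (@continuous_comp _ _ _ (form_in_chart g c \o cmap c)
  (fun A : 'M[R]_n => A i j)) => //; exact: coord_continuous.
Qed.

Lemma inv_form_in_chart_continuous c x i j : atlas c -> cdom c x ->
  {for x, continuous (fun x => invmx (form_in_chart g c (cmap c x)) i j)}.
Proof.
move=> ac cx; apply: cvg_invmx => [k l||].
- exact: form_in_chart_continuous.
- exact: form_in_chart_unit.
- near=> y; apply: form_in_chart_unit => //; near: y; exact: near_chart_dom.
Unshelve. all: by end_near. Qed.

Lemma derivable_chart c f x v : atlas c -> cdom c x -> differentiable_at f x ->
  derivable (f \o cinv c) (cmap c x) v.
Proof.
move=> ac cx df.
apply: (@near_eq_derivable _ _ _
  ((f \o cinv (chart_at x)) \o transition c (chart_at x))).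
  near=> y; rewrite /transition/= cmapK//.
  near: y; apply: near_chart_inv => //; apply: near_chart_dom; exact: chart_at_dom.
apply: diff_derivable; apply: differentiable_comp.
  by apply: transition_differentiable => //; [exact: chart_at_atlas|exact: chart_at_dom].
by rewrite transitionE.
Unshelve. all: by end_near. Qed.

(** A partial derivative is the pointwise limit of difference quotients with steps 1/(k+1), each
    continuous on an open set. *)
Lemma measurable_chart_partials c f i (D : set (borel M)) : atlas c ->
  continuous f -> measurable D -> D `<=` cdom c ->
  (forall x, D x -> differentiable_at f x) ->
  measurable_fun D (fun x : borel M => chart_partials c f x 0 i).
Proof.
move=> ac cf mD Dc df.
pose e := delta_mx 0 i : 'rV[R]_n.
(* [U k] is where the shifted point stays in the chart. The quotient is set to 0 elsewhere; this
   does not affect the limit, since each point of [D] lies in [U k] for all large k. *)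
pose U k := cdom c `&` cmap c @^-1` [set y | ccod c (k.+1%:R^-1 *: e + y)].
have oU k : open (U k).
  rewrite openE => x [cx cUx]; apply: filterI; first exact: near_chart_dom.
  apply: (cmap_continuous cx).
  have : {for cmap c x, continuous (fun y => k.+1%:R^-1 *: e + y)}.
    by apply: continuousD; [exact: cst_continuous|exact: id].
  by apply; apply: open_nbhs_nbhs; split; [exact: ccod_open|].
pose q k (x : borel M) : R :=
  k.+1%:R * (f (cinv c (k.+1%:R^-1 *: e + cmap c x)) - f x).
have mU k : measurable (U k : set (borel M)) by exact: sub_sigma_algebra.
pose qq : (borel M -> R)^nat := fun k => q k \_ (U k).
apply: (@measurable_fun_cvg _ (borel M) R D qq (fun x => chart_partials c f x 0 i)).
  move=> k; apply/(measurable_restrict _ (mU k) mD).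
  have qU : measurable_fun (U k : set (borel M)) (q k);
    last by apply: measurable_funS qU => // x [].
  apply: measurable_continuous_open => // x [cx cUx].
  apply: continuousM; first exact: cst_continuous.
  apply: continuousB; last exact: cf.
  apply: (@continuous_comp _ _ _ (fun x => cinv c (k.+1%:R^-1 *: e + cmap c x)) f);
    last exact: cf.
  apply: (@continuous_comp _ _ _ (fun x => k.+1%:R^-1 *: e + cmap c x) (cinv c)).
    by apply: continuousD; [exact: cst_continuous|exact: cmap_continuous].
  exact: cinv_continuous.
move=> x Dx; rewrite /chart_partials mxE.
have cx := Dc x Dx.
have hk0 : (fun k => k.+1%:R^-1 : R) @ \oo --> (0 : R)^'.
  move=> P; rewrite /dnbhs/within/= => P0.
  have := @cvg_harmonic R _ P0.
  apply: (@filterS _ \oo _ (harmonic @^-1` [set y | y != 0 -> P y])) => k; apply.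
  by rewrite invr_eq0 pnatr_eq0.
have dv := derivable_chart (v := e) ac cx (df x Dx).
have := cvg_comp _ _ hk0 dv; apply: cvg_trans; apply: near_eq_cvg.
have near_ccod : \forall k \near \oo, U k x.
  have : (fun k => k.+1%:R^-1 *: e + cmap c x) @ \oo --> 0 *: e + cmap c x.
    apply: cvgD; last exact: cvg_cst.
    by apply: cvgZr_tmp; exact: cvg_harmonic.
  rewrite scale0r add0r => h; near=> k; split => //=; near: k; apply: h.
  by apply: open_nbhs_nbhs; split; [exact: ccod_open|exact: cmap_fun].
near=> k; rewrite /qq /patch mem_set; last by near: k.
by rewrite /q/= cmapK// invrK.
Unshelve. all: by end_near. Qed.

Lemma measurable_inner_grad (D K : set M) f h :
  measurable (D : set (borel M)) -> measurable (K : set (borel M)) -> compact K ->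
  continuous f -> continuous h ->
  (forall x, D x -> differentiable_at f x /\ differentiable_at h x) ->
  measurable_fun (D `&` K : set (borel M))
    (fun x : borel M => inner g x (grad g f x) (grad g h x)).
Proof.
move=> mD mK cK cf ch dfh.
pose G (x : borel M) := inner g x (grad g f x) (grad g h x).
(* A measurable superset is requested because [compact_ind] passes through arbitrary sets. Locally
   that superset is a chart domain, where the product is a finite sum of measurable terms. *)
pose P (S : set M) := exists U : set (borel M),
  [/\ measurable U, S `<=` U & measurable_fun (D `&` U : set (borel M)) G].
suff [U [mU KU mG]] : P K.
  have : measurable (D `&` U : set (borel M)) by exact: measurableI.
  by move=> /measurable_funS; apply => // x [Dx Kx]; split => //; exact: KU.
apply: compact_ind => //.
- by exists set0; split => //; rewrite setI0; exact: measurable_fun_set0.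
- move=> A B [U [mU AU mG]] [W [mW BW mG']]; exists (U `|` W); split.
  + exact: measurableU.
  + exact: setUSS.
  + by rewrite setIUr; apply/measurable_funU => //; exact: measurableI.
- move=> A B AB [U [mU BU mG]]; exists U; split => //; exact: subset_trans BU.
move=> x Kx; pose c := chart_at x; have ac : atlas c := chart_at_atlas x.
exists (cdom c); first by apply: near_chart_dom; exact: chart_at_dom.
have mc : measurable (cdom c : set (borel M)).
  by apply: sub_sigma_algebra; exact: cdom_open.
exists (cdom c); split => //.
have mDc : measurable (D `&` cdom c : set (borel M)) by exact: measurableI.
apply: (eq_measurable_fun (fun x : borel M => \sum_j
  (\sum_i chart_partials c f x 0 i * invmx (form_in_chart g c (cmap c x)) i j)
  * chart_partials c h x 0 j)).
  move=> y /set_mem [Dy cy]; rewrite /G (inner_grad_chart g ac cy); last 2 first.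
  - by have [] := dfh y Dy.
  - by have [] := dfh y Dy.
  by rewrite !mxE; apply: eq_bigr => j _; rewrite !mxE.
apply: measurable_sum => j; apply: measurable_funM; last first.
  by apply: measurable_chart_partials => // y [Dy cy] //; have [] := dfh y Dy.
apply: measurable_sum => i; apply: measurable_funM.
  by apply: measurable_chart_partials => // y [Dy cy] //; have [] := dfh y Dy.
have mi : measurable_fun (cdom c : set (borel M))
    (fun x : borel M => invmx (form_in_chart g c (cmap c x)) i j).
  apply: (measurable_continuous_open (cdom_open c)) => y cy.
  exact: inv_form_in_chart_continuous.
by apply: measurable_funS mi => // y [].
Qed.

End ChartMeasurability.

(** * Lengths of curves *)

(** Real induction on the supremum of the points satisfying [P]. The step jumps across [t], from a
    nearby point on its left to any nearby point on its right, so it both reaches the supremum and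
    goes past it. *)
Lemma segment_ind {R : realType} (P : R -> Prop) (a b : R) : a <= b -> P a ->
  (forall t, a <= t <= b -> exists2 e, 0 < e & forall s s',
     a <= s <= t -> t <= s' <= b -> t - e < s -> s' < t + e -> P s -> P s') ->
  P b.
Proof.
move=> ab Pa step; pose S := [set t | a <= t <= b /\ P t].
have Sa : S a by split; rewrite ?lexx.
have hS : has_sup S by split; [exists a|exists b => t [/andP[]]].
have aS : a <= sup S by apply: ub_le_sup => //; case: hS.
have Sb : sup S <= b by apply: sup_le_ub; [exists a|move=> t [/andP[]]].
have [|e e0 He] := step (sup S); first by rewrite aS.
have [s [/andP[as_ sb] Ps] es] := sup_adherent e0 hS.
have sS : s <= sup S by apply: ub_le_sup; [case: hS|split => //; rewrite as_].
have key s' : sup S <= s' <= b -> s' < sup S + e -> P s'.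
  by move=> h1 h2; apply: (He s) => //; rewrite as_.
have [bS|Sltb] := leP b (sup S).
  by apply: key; [rewrite Sb lexx|apply: le_lt_trans bS _; rewrite ltrDl].
(* A point strictly beyond the supremum, still in [a, b] and within reach of the step: a
   contradiction. *)
pose m := Num.min b (sup S + e / 2).
have e2 : 0 < e / 2 by lra.
have Sm : sup S < m by rewrite lt_min Sltb ltrDl.
have : m <= sup S.
  apply: ub_le_sup; first by case: hS.
  have mb : m <= b by rewrite ge_min lexx.
  split; first by rewrite mb andbT (le_trans aS)// ltW.
  apply: key; first by rewrite mb ltW.
  by rewrite gt_min; apply/orP; right; lra.
by rewrite leNgt Sm.
Qed.

(** Once the null point [t] is removed from the first interval the two are disjoint, and
    superadditivity of the lower integral applies; [F] is arbitrary, hence an inequality. *)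
Lemma ge0_integral_itv_concat {R : realType} (F : R -> \bar R) (a t b : R) :
  (forall x, (0 <= F x)%E) -> a <= t -> t <= b ->
  (\int[lebesgue_measure]_(x in `[a, t]) F x +
   \int[lebesgue_measure]_(x in `[t, b]) F x <=
   \int[lebesgue_measure]_(x in `[a, b]) F x)%E.
Proof.
move=> F0 at_ tb.
rewrite [X in (X + _)%E](@integral_setD_null _ _ R lebesgue_measure _ _ F (measurable_set1 t));
  last first.
  exact: lebesgue_measure_set1.
rewrite [X in (X + _)%E]integral_mkcond [X in (_ + X)%E]integral_mkcond [leRHS]integral_mkcond.
apply: (@le_trans _ _ _ _ _ (ge0_integralD_ge _ _ _)).
- by move=> x; apply: erestrict_ge0.
- by move=> x; apply: erestrict_ge0.
apply: ge0_le_integral_nonmeasurable => x _.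
  by apply: adde_ge0; apply: erestrict_ge0.
rewrite /patch; case: ifPn => [|_].
  rewrite inE/= in_itv/= => -[/andP[ax xt] /eqP xnt].
  rewrite ifF; last first.
    by apply/negbTE; rewrite notin_setE/= in_itv/= => /andP[tx _];
       move: xnt; rewrite eq_le tx xt.
  by rewrite adde0 ifT// inE/= in_itv/= ax (le_trans xt).
rewrite add0e; case: ifPn => [|_].
  by rewrite inE/= in_itv/= => /andP[tx xb]; rewrite ifT// inE/= in_itv/= xb (le_trans at_).
by case: ifPn.
Qed.

Section Curves.
Context {R : realType} {n : nat} {M : @smooth_manifold R n}.
Variable g : riemannian_metric M.
Implicit Types (f : M -> R) (c : R -> M) (a b t : R).

Lemma smooth_curve_sub c a b a' b' : a <= a' -> b' <= b ->
  smooth_curve c a b -> smooth_curve c a' b'.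
Proof.
move=> aa bb cab t /andP[at_ tb]; apply: cab.
by rewrite (le_trans aa) ?(le_trans tb).
Qed.

Lemma curve_length_ge0 c a b : (0 <= curve_length g c a b)%E.
Proof. by apply: integral_ge0 => t _; rewrite lee_fin sqrtr_ge0. Qed.

Lemma curve_length_concat c a t b : a <= t -> t <= b ->
  (curve_length g c a t + curve_length g c t b <= curve_length g c a b)%E.
Proof. by move=> at_ tb; apply: ge0_integral_itv_concat => // x; rewrite lee_fin sqrtr_ge0. Qed.

Lemma riem_dist_curve c a b : a <= b -> smooth_curve c a b ->
  (riem_dist g (c a) (c b) <= curve_length g c a b)%E.
Proof.
move=> ab cab; apply: ereal_inf_lbound => /=.
rewrite -[curve_length _ _ _ _]add0e.
exact: (joined_step (joined_refl g (c a)) ab cab erefl).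
Qed.

Lemma joined_ge0 x y l : joined g x y l -> (0 <= l)%E.
Proof.
by elim=> // z l' c a b _ l0 _ _ _; rewrite adde_ge0// curve_length_ge0.
Qed.

Lemma riem_dist_ge0 x y : (0 <= riem_dist g x y)%E.
Proof. by apply: le_ereal_inf_tmp => l; exact: joined_ge0. Qed.

(** The bound for one smooth piece passes to a chain of pieces by induction on [joined] and the
    triangle inequality, then to the infimum of lengths. *)
Lemma lipschitz_of_curves f L : 0 < L ->
  (forall c a b, a <= b -> smooth_curve c a b ->
    (`|f (c b) - f (c a)|%:E <= L%:E * curve_length g c a b)%E) ->
  lipschitz_in g setT f.
Proof.
move=> L0 fc; exists L => // x y _ _; rewrite -lee_pdivrMl//.
apply: le_ereal_inf_tmp => l xyl; rewrite lee_pdivrMl// distrC.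
elim: xyl => [|z {}l c a b xzl IH ab cab ca]; first by rewrite subrr normr0 mule0.
rewrite ge0_muleDr; last 2 first.
- exact: joined_ge0 xzl.
- exact: curve_length_ge0.
apply: le_trans (leeD IH (fc c a b ab cab)).
by rewrite -EFinD lee_fin ca [leRHS]addrC ler_distD.
Qed.

(* A curve is cut into pieces on which the local bound applies, and the lengths
   of the pieces add up: small distance balls need not be compared with charts. *)
Lemma locally_lipschitz_curves f L : 0 < L ->
  (forall x : M, exists2 U : set M, nbhs x U & forall y z, U y -> U z ->
     (`|f y - f z|%:E <= L%:E * riem_dist g y z)%E) ->
  lipschitz_in g setT f.
Proof.
move=> L0 fU; apply: (lipschitz_of_curves L0) => c a b ab cab.
pose P t := a <= t <= b ->
  (`|f (c t) - f (c a)|%:E <= L%:E * curve_length g c a t)%E.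
suff : P b by apply; rewrite ab lexx.
apply: (segment_ind ab) => [_|t atb].
  by rewrite subrr normr0 mule_ge0 ?curve_length_ge0// lee_fin ltW.
have [U xU fUx] := fU (c t); have [cct _] := cab t atb.
have /nbhs_ballP[e /= e0 eU] := cct _ xU.
exists e => // s s' /andP[as_ st] /andP[ts' s'b] es s'e Ps _.
have Us : U (c s) by apply: eU; rewrite /ball/= ger0_norm; lra.
have Us' : U (c s') by apply: eU; rewrite /ball/= ler0_norm; lra.
have ss' : s <= s' by exact: le_trans ts'.
have css' : smooth_curve c s s' by apply: smooth_curve_sub cab.
apply: (@le_trans _ _ (L%:E * (curve_length g c a s + curve_length g c s s')))%E;
  last by rewrite lee_pmul2l// curve_length_concat.
rewrite ge0_muleDr ?curve_length_ge0//.
apply: (@le_trans _ _ (`|f (c s) - f (c a)|%:E + `|f (c s') - f (c s)|%:E)%E).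
  by rewrite -EFinD lee_fin [leRHS]addrC ler_distD.
apply: leeD; first by apply: Ps; rewrite as_ (le_trans st)//; case/andP: atb.
rewrite distrC; apply: le_trans (fUx _ _ Us Us') _.
by rewrite lee_pmul2l// riem_dist_curve.
Qed.

End Curves.

(** * Continuity of the Riemannian distance *)

Lemma ler_coord_norm {R : realType} m n (A : 'M[R]_(m, n)) i j : `|A i j| <= `|A|.
Proof.
by rewrite [leRHS]/Num.norm/= mx_normrE; apply/bigmax_geP; right => /=; exists (i, j).
Qed.

Lemma ler_quadratic_form {R : realType} n (A : 'M[R]_n) (v : 'rV[R]_n) :
  (v *m A *m v^T) 0 0 <= (n ^ 2)%:R * `|A| * `|v| ^+ 2.
Proof.
rewrite mxE; under eq_bigr do rewrite !mxE mulr_suml.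
apply: (@le_trans _ _ (\sum_(j < n) \sum_(i < n) (`|A| * `|v| ^+ 2))).
  apply: ler_sum => j _; apply: ler_sum => i _; apply: le_trans (ler_norm _) _.
  rewrite !normrM mulrAC mulrC expr2.
  by rewrite ler_pM// ?mulr_ge0// ?ler_pM// ?ler_coord_norm.
rewrite !sumr_const !card_ord -mulrnA -[leLHS]mulr_natl mulrA.
by rewrite -mulnn.
Qed.

(** The difference quotients of the composite in direction [w] are literally those of [f] in
    direction [w *: v], so the derivatives agree as limits without any existence argument, and
    induction on [k] applies. *)
Lemma Ck_on_affine {R : realType} (E F : normedModType R) k (W : set E)
    (f : E -> F) (y v : E) : Ck_on k W f ->
  Ck_on k [set s : R | W (y + s *: v)] (fun s : R => f (y + s *: v)).
Proof.
have cA (s : R) : {for s, continuous (fun s : R => y + s *: v)}.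
  by apply: cvgD; [exact: cvg_cst|apply: cvgZr_tmp; exact: cvg_id].
elim: k f => [|k IH] f /=.
  move=> fW s Ws; apply: (@continuous_comp _ _ _ (fun s : R => y + s *: v) f) => //.
  by have := fW _ Ws.
move=> [df dk]; split=> [s Ws|w].
  apply: (@differentiable_comp _ _ _ _ (fun s : R => y + s *: v) f).
    by apply: differentiableD => //; apply: differentiableZl.
  exact: df.
rewrite (_ : (fun _ => _) = fun s : R => 'D_(w *: v) f (y + s *: v));
  first by have := IH _ (dk (w *: v)).
apply/funext => s; apply: (congr1 (fun q : R -> F => lim (q @ 0^'))); apply/funext => h /=.
by congr (_ *: (f _ - _)); rewrite scalerDl scalerA addrCA.
Qed.

Section Segments.
Context {R : realType} {n : nat} {M : @smooth_manifold R n}.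
Variable g : riemannian_metric M.
Implicit Types (c : @chart R n M) (x : M).

Lemma open_transition c c' : open (ccod c `&` cinv c @^-1` cdom c').
Proof.
rewrite openE => y [cy c'y]; apply: filterI.
  by apply: open_nbhs_nbhs; split => //; exact: ccod_open.
by apply: (cinv_continuous cy); exact: near_chart_dom.
Qed.

(** Smoothness of a curve is tested in the preferred chart of each of its points, so the straight
    segment is composed with a transition map. *)
Lemma smooth_segment c (y v : 'rV[R]_n) : atlas c ->
  (forall t : R, 0 <= t <= 1 -> ccod c (y + t *: v)) ->
  smooth_curve (fun t => cinv c (y + t *: v)) 0 1.
Proof.
move=> ac cyv t t01; have cA (s : R) : {for s, continuous (fun s : R => y + s *: v)}.
  by apply: cvgD; [exact: cvg_cst|apply: cvgZr_tmp; exact: cvg_id].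
split.
  apply: (@continuous_comp _ _ _ (fun s : R => y + s *: v) (cinv c)) => //.
  exact/cinv_continuous/cyv.
set c' := chart_at _; have ac' : atlas c' by exact: chart_at_atlas.
exists [set s : R | (ccod c `&` cinv c @^-1` cdom c') (y + s *: v)].
  split; last by split; [exact: cyv|exact: chart_at_dom].
  suff : open ((fun s : R => y + s *: v) @^-1` (ccod c `&` cinv c @^-1` cdom c')) by [].
  apply: open_comp; last exact: open_transition.
  by move=> s _; exact: cA.
by move=> k; exact: (Ck_on_affine y v (atlas_compatible ac ac' k)).
Qed.

Lemma velocity_segment c (y v : 'rV[R]_n) (t : R) : atlas c -> ccod c (y + t *: v) ->
  let cv := fun t => cinv c (y + t *: v) in
  inner g (cv t) (velocity cv t) (velocity cv t) =
  (v *m form_in_chart g c (y + t *: v) *m v^T) 0 0.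
Proof.
move=> ac cyv cv; set c' := chart_at (cv t).
have -> : velocity cv t = v *m jacobian (transition c c') (y + t *: v).
  rewrite -deriveEjacobian; last first.
    rewrite -(cinvK cyv); apply: transition_differentiable => //.
    - exact: chart_at_atlas.
    - exact: cinv_fun.
    - exact: chart_at_dom.
  rewrite /velocity derive1E.
  apply: (congr1 (fun q : R -> 'rV[R]_n => lim (q @ 0^'))); apply/funext => h /=.
  congr (_ *: (cmap c' (cinv c _) - _)).
  by rewrite scalerDl [h *: 1]mulr1 addrCA.
by rewrite /inner /form_in_chart trmx_mul !mulmxA.
Qed.

(** A straight chart segment to a nearby point has length at most a constant times its coordinate
    length, since the metric matrix is bounded near [x]. This makes Lipschitz functions continuous
    for the manifold topology. *)
Lemma riem_dist_near x (e : R) : 0 < e -> \forall y \near x, (riem_dist g x y < e%:E)%E.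
Proof.
move=> e0; pose c := chart_at x; have ac : atlas c := chart_at_atlas x.
have cx : cdom c x := chart_at_dom x.
have := metric_smooth g ac 0 _ (cmap_fun cx).
set y0 := cmap c x => cform.
pose K := `|form_in_chart g c y0| + 1.
have yK : `|form_in_chart g c y0| < K by rewrite ltrDl.
have nK : \forall y \near y0, `|form_in_chart g c y| < K by exact: (cvgr_norm_lt _ cform).
have : \forall y \near y0, ccod c y /\ `|form_in_chart g c y| < K.
  by apply: filterI => //; exact: near_chart.
move=> /nbhs_ballP[r /= r0 rK].
(* The square root bounds speed by the sup norm, with n^2 counting the terms of the quadratic form;
   the added 1 keeps [C] positive when [n] is 0. *)
pose C := Num.sqrt ((n ^ 2)%:R * K) + 1.
have C0 : 0 < C by rewrite ltr_wpDl ?sqrtr_ge0.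
have K0 : 0 <= K by rewrite addr_ge0.
near=> z.
have cz : cdom c z by near: z; exact: near_chart_dom.
pose v := cmap c z - y0.
have vr : `|v| < r.
  rewrite /v; near: z.
  have := cmap_continuous cx; move/cvgr_dist_lt => /(_ r r0).
  by apply: filterS => z; rewrite distrC.
have ve : `|v| < e / C.
  rewrite /v; near: z.
  have := cmap_continuous cx; move/cvgr_dist_lt => /(_ (e / C)).
  rewrite divr_gt0// => /(_ isT).
  by apply: filterS => z; rewrite distrC.
have seg t : 0 <= t <= 1 -> ccod c (y0 + t *: v) /\ `|form_in_chart g c (y0 + t *: v)| < K.
  move=> /andP[t0 t1]; apply: rK; rewrite -ball_normE/= opprD addNKr normrN normrZ.
  by apply: le_lt_trans vr; rewrite ger0_norm// ler_piMl.
pose cv := fun t : R => cinv c (y0 + t *: v).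
have scv : smooth_curve cv 0 1 by apply: smooth_segment => // t /seg[].
have cv0 : cv 0 = x by rewrite /cv scale0r addr0 cmapK.
have cv1 : cv 1 = z by rewrite /cv scale1r /v addrC subrK cmapK.
rewrite -cv0 -cv1; apply: le_lt_trans (riem_dist_curve g ler01 scv) _.
apply: (@le_lt_trans _ _ (C * `|v|)%:E); last first.
  by rewrite lte_fin mulrC -ltr_pdivlMr.
apply: (@le_trans _ _ (\int[lebesgue_measure]_(t in `[0%R, 1%R]) (cst (C * `|v|)%:E t))%E).
  apply: ge0_le_integral_nonmeasurable => t.
    by rewrite lee_fin sqrtr_ge0.
  rewrite /= in_itv/= => /seg[ct Kt]; rewrite lee_fin /tnorm velocity_segment//.
  apply: (@le_trans _ _ (Num.sqrt ((n ^ 2)%:R * K * `|v| ^+ 2))).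
    apply: ler_wsqrtr; apply: le_trans (ler_quadratic_form _ _) _.
    apply: ler_wpM2r; first exact: exprn_ge0.
    apply: ler_wpM2l; first exact: ler0n.
    exact: (ltW Kt).
  rewrite sqrtrM; last by apply: mulr_ge0; [exact: ler0n|].
  rewrite sqrtr_sqr normr_id; apply: ler_wpM2r => //.
  by rewrite /C lerDl.
by rewrite integral_cst//= lebesgue_measure_itv/= lte_fin ltr01 oppr0 adde0 mule1.
Unshelve. all: by end_near. Qed.

Lemma lipschitz_in_continuous (f : M -> R) (U : set M) x : nbhs x U ->
  lipschitz_in g U f -> {for x, continuous f}.
Proof.
move=> xU [K K0 fK]; apply/cvgrPdist_lt => e e0; near=> y.
rewrite -lte_fin; apply: le_lt_trans (fK _ _ _ _) _.
- exact: nbhs_singleton xU.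
- by near: y.
- rewrite -lte_pdivlMl// -EFinM mulrC; near: y.
  by apply: riem_dist_near; rewrite divr_gt0.
Unshelve. all: by end_near. Qed.

Lemma locally_lipschitz_continuous (f : M -> R) : locally_lipschitz g f -> continuous f.
Proof. by move=> fl x; have [U xU] := fl x; exact: lipschitz_in_continuous. Qed.

End Segments.

(** * Smooth functions are Lipschitz *)

Section SmoothFunctions.
Context {R : realType} {n : nat} {M : @smooth_manifold R n}.
Variable g : riemannian_metric M.
Implicit Types (c : @chart R n M) (x : M).

Lemma inner_sym x v w : inner g x v w = inner g x w v.
Proof.
rewrite /inner -[in LHS](trmxK (v *m g x *m w^T)) [LHS]mxE.
by rewrite !trmx_mul trmxK metric_sym mulmxA.
Qed.

Lemma inner_ge0 x v : 0 <= inner g x v v.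
Proof.
have [->|v0] := eqVneq v 0; first by rewrite /inner mul0mx mul0mx mxE.
exact/ltW/metric_pos.
Qed.

Lemma innerZl x k v w : inner g x (k *: v) w = k * inner g x v w.
Proof. by rewrite /inner -!scalemxAl mxE. Qed.

Lemma innerZr x k v w : inner g x v (k *: w) = k * inner g x v w.
Proof. by rewrite inner_sym innerZl inner_sym. Qed.

Lemma innerDl x v v' w : inner g x (v + v') w = inner g x v w + inner g x v' w.
Proof. by rewrite /inner !mulmxDl mxE. Qed.

Lemma innerDr x v w w' : inner g x v (w + w') = inner g x v w + inner g x v w'.
Proof. by rewrite inner_sym innerDl !(inner_sym x _ v). Qed.

Lemma cauchy_schwarz_inner x v w : `|inner g x v w| <= tnorm g x v * tnorm g x w.
Proof.
have [->|v0] := eqVneq v 0.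
  by rewrite /inner !mul0mx mxE normr0 mulr_ge0 ?sqrtr_ge0.
rewrite /tnorm -sqrtrM ?inner_ge0// -sqrtr_sqr; apply: ler_wsqrtr.
(* This vector has squared length <v,v> (<v,v> <w,w> - <v,w>^2), and the first factor is
   positive. *)
have := inner_ge0 x (inner g x v v *: w + (- inner g x v w) *: v).
have : 0 < inner g x v v by exact: metric_pos.
rewrite !(innerDl, innerDr, innerZl, innerZr) (inner_sym x w v).
move: (inner g x v v) (inner g x v w) (inner g x w w) => a b d a0 h.
rewrite -subr_ge0 -(pmulr_rge0 _ a0); apply: le_trans h _.
by rewrite le_eqVlt; apply/orP; left; apply/eqP; ring.
Qed.

Lemma smooth_differentiable (phi : M -> R) x : smooth_fun phi -> differentiable_at phi x.
Proof.
move=> sphi; have [+ _] := sphi _ (chart_at_atlas x) 1; apply.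
exact/cmap_fun/chart_at_dom.
Qed.

Lemma smooth_continuous (phi : M -> R) : smooth_fun phi -> continuous phi.
Proof.
move=> sphi x; have ax := chart_at_atlas x; have dx := chart_at_dom x.
have := sphi _ ax 0 _ (cmap_fun dx) => cphi.
have := continuous_comp (cmap_continuous dx) cphi.
have phix : ((phi \o cinv (chart_at x)) \o cmap (chart_at x)) x = phi x.
  by rewrite /= cmapK.
rewrite /continuous_at [X in _ --> X -> _]phix; apply: cvg_trans; apply: near_eq_cvg.
near=> y; rewrite /= cmapK//; near: y; exact: near_chart_dom.
Unshelve. all: by end_near. Qed.

Lemma chart_partials_continuous c (phi : M -> R) x i : smooth_fun phi ->
  atlas c -> cdom c x ->
  {for x, continuous (fun x => chart_partials c phi x 0 i)}.
Proof.
move=> sphi ac cx; have [_ +] := sphi c ac 1.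
move=> /(_ (delta_mx 0 i) _ (cmap_fun cx)) dphi.
rewrite (_ : (fun _ => _) = 'D_(delta_mx 0 i) (phi \o cinv c) \o cmap c); last first.
  by apply/funext => y; rewrite /chart_partials mxE.
apply: (@continuous_comp _ _ _ (cmap c) ('D_(delta_mx 0 i) (phi \o cinv c))).
  exact: cmap_continuous.
by have := dphi.
Qed.

Lemma grad_support (phi : M -> R) x : ~ support phi x -> grad g phi x = 0.
Proof.
move=> sx; rewrite gradE; suff -> : chart_partials (chart_at x) phi x = 0 by rewrite mul0mx.
rewrite /chart_partials (@near_eq_partials _ _ _ (cst 0)).
  by apply/rowP => i; rewrite !mxE derive_cst.
near=> y; rewrite /=; apply: contrapT => /eqP py.
have : ~ support phi (cinv (chart_at x) y); last by apply; exact: subset_closure.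
near: y; apply: (near_chart_inv (P := ~` support phi)); first exact: chart_at_dom.
apply: (@open_nbhs_nbhs _ _ (~` support phi)); split => //.
by apply: closed_openC; exact: closed_closure.
Unshelve. all: by end_near. Qed.

(** Near each point the squared norm agrees with an expression in one fixed chart, which is
    continuous and so locally bounded; compactness handles the support, and the gradient vanishes
    off it. *)
Lemma smooth_grad_bounded (phi : M -> R) : smooth_fun phi -> compact (support phi) ->
  exists2 b, 0 < b & forall x, tnorm g x (grad g phi x) <= b.
Proof.
move=> sphi cphi.
pose G x := inner g x (grad g phi x) (grad g phi x).
suff [b Gb] : exists b, forall x, support phi x -> G x <= b.
  exists (Num.sqrt `|b| + 1) => [|x]; first by rewrite ltr_wpDl ?sqrtr_ge0.
  have [sx|sx] := pselect (support phi x).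
    apply: ler_wpDr => //; apply: ler_wsqrtr; apply: le_trans (Gb x sx) _.
    exact: ler_norm.
  by rewrite /tnorm grad_support// /inner !mul0mx mxE sqrtr0 addr_ge0 ?sqrtr_ge0.
apply: (compact_ind (P := fun S => exists b, forall x, S x -> G x <= b)) => //.
- by exists 0.
- move=> A B [b Ab] [b' Bb']; exists (Num.max b b') => x [/Ab|/Bb'] h.
    by rewrite le_max h.
  by rewrite le_max h orbT.
- by move=> A B AB [b Bb]; exists b => x /AB; exact: Bb.
move=> x _; pose c := chart_at x; have ac : atlas c := chart_at_atlas x.
have cx : cdom c x := chart_at_dom x.
pose Q (x : M) := \sum_j
  (\sum_i chart_partials c phi x 0 i * invmx (form_in_chart g c (cmap c x)) i j)
  * chart_partials c phi x 0 j.
have GQ y : cdom c y -> G y = Q y.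
  move=> cy; have dy := smooth_differentiable y sphi.
  rewrite /G (inner_grad_chart g ac cy)// !mxE.
  by apply: eq_bigr => j _; rewrite !mxE.
have cQ : {for x, continuous Q}.
  apply: cvg_big => [|j _]; first exact: add_continuous.
  apply: cvgM; last exact: chart_partials_continuous.
  apply: cvg_big => [|i _]; first exact: add_continuous.
  by apply: cvgM; [exact: chart_partials_continuous|exact: inv_form_in_chart_continuous].
exists [set y | cdom c y /\ Q y <= Q x + 1].
  apply: filterI; first exact: near_chart_dom.
  by apply: (cvgr_le _ cQ); rewrite ltrDl.
by exists (Q x + 1) => y [cy]; rewrite GQ.
Qed.

End SmoothFunctions.

Section SmoothAlongCurves.
Context {R : realType} {n : nat} {M : @smooth_manifold R n}.
Variable g : riemannian_metric M.
Implicit Types (x : M).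

Lemma smooth_along_curve (phi : M -> R) (c : R -> M) (a b t : R) :
  smooth_fun phi -> smooth_curve c a b -> a <= t <= b ->
  [/\ derivable (phi \o c) t 1,
      'D_1 (phi \o c) t = inner g (c t) (grad g phi (c t)) (velocity c t) &
      {for t, continuous ('D_1 (phi \o c))}].
Proof.
move=> sphi cab tab; have [ct [U [oU Ut] sU]] := cab t tab.
set c' := chart_at (c t) in sU; have ac' : atlas c' := chart_at_atlas _.
have dc' : cdom c' (c t) := chart_at_dom _.
pose gam := cmap c' \o c; pose f := phi \o cinv c'.
have near_dom : \forall s \near t, cdom c' (c s) by apply: ct; exact: near_chart_dom.
have near_U : \forall s \near t, U s by exact: open_nbhs_nbhs.
have [df df'] := sphi c' ac' 1; have [dgam dgam'] := sU 1.
have fgam s : cdom c' (c s) -> phi (c s) = f (gam s).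
  by move=> cs; rewrite /f /gam/= cmapK.
have near_eq : \forall s \near t, \forall r \near s, (f \o gam) r = (phi \o c) r.
  have := nbhs_interior near_dom; apply: filterS => s; apply: filterS => r /= cr.
  by rewrite -fgam.
(* The chart is frozen at [c t], so this formula gives the derivative at every [s] near [t] and
   shows its continuity. The gradient and the velocity use that same chart only at [s = t]. *)
pose h' s := \sum_i 'D_1 gam s 0 i * 'D_(delta_mx 0 i) f (gam s).
have Dfgam s : U s -> cdom c' (c s) -> 'D_1 (f \o gam) s = h' s.
  move=> Us cs; have dfs : differentiable f (gam s) by exact/df/cmap_fun.
  have dgs : differentiable gam s by exact: dgam.
  rewrite deriveE; last exact: differentiable_comp.
  rewrite diff_comp//= -(deriveE _ dfs) (diff_partials _ dfs) !mxE.
  by apply: eq_bigr => i _; rewrite !mxE (deriveE _ dgs).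
have near_D : \forall s \near t, h' s = 'D_1 (phi \o c) s.
  near=> s; rewrite -Dfgam; [|by near: s..].
  by apply: near_eq_derive; near: s.
split.
- apply: (near_eq_derivable (nbhs_singleton near_eq)).
  apply: diff_derivable; apply: differentiable_comp; first exact: dgam.
  exact/df/cmap_fun.
- rewrite -(nbhs_singleton near_D) /inner gradE mulmxKV ?metric_unit// mxE.
  apply: eq_bigr => i _; rewrite !mxE mulrC; congr (_ * _).
  by rewrite /velocity derive1E.
- have ch' : {for t, continuous h'}.
    apply: cvg_big => [|i _]; first exact: add_continuous.
    have cgam : {for t, continuous gam}.
      by apply: differentiable_continuous; exact: dgam.
    apply: cvgM.
      apply: (@continuous_comp _ _ _ ('D_1 gam) (fun v : 'rV[R]_n => v 0 i)).
        by have := dgam' 1 t Ut.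
      exact: coord_continuous.
    apply: (@continuous_comp _ _ _ gam ('D_(delta_mx 0 i) f)) => //.
    by have := df' (delta_mx 0 i) _ (cmap_fun dc').
  suff : 'D_1 (phi \o c) @ t --> h' t by rewrite (nbhs_singleton near_D).
  by apply: cvg_trans ch'; exact: near_eq_cvg near_D.
Unshelve. all: by end_near. Qed.

Lemma smooth_lipschitz (phi : M -> R) : smooth_fun phi -> compact (support phi) ->
  lipschitz_in g setT phi.
Proof.
move=> sphi cphi; have [B B0 gB] := smooth_grad_bounded g sphi cphi.
apply: (lipschitz_of_curves B0) => c a b; rewrite le_eqVlt => /predU1P[<- _|ab cab].
  by rewrite subrr normr0 mule_ge0 ?curve_length_ge0// lee_fin ltW.
pose h := phi \o c; pose h' : R -> R := 'D_1 h.
have along t := @smooth_along_curve phi c a b t sphi cab.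
have ch t : a <= t <= b -> {for t, continuous h}.
  move=> /along[dh _ _]; apply: differentiable_continuous; exact/derivable1_diffP.
have ch' : {within `[a, b], continuous h'}.
  apply: continuous_in_subspaceT => t; rewrite inE/= in_itv/= => /along[_ _].
  exact.
have FTC : (\int[lebesgue_measure]_(x in `[a, b]) (h' x)%:E = (h b)%:E - (h a)%:E)%E.
  apply: continuous_FTC2 => //.
    split.
    - move=> t; rewrite in_itv/= => /andP[at_ tb].
      by have [] := along t; rewrite ?(ltW at_) ?(ltW tb).
    - by apply: cvg_at_right_filter; apply: ch; rewrite lexx ltW.
    - by apply: cvg_at_left_filter; apply: ch; rewrite lexx ltW.
  by move=> t _; rewrite derive1E.
have mh' : measurable_fun (`[a, b] : set R) h'.
  exact: subspace_continuous_measurable_fun.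
have -> : (`|phi (c b) - phi (c a)|%:E =
    `|\int[lebesgue_measure]_(x in `[a, b]) (h' x)%:E|)%E by rewrite FTC.
apply: le_trans (le_abse_integral _ _ _) _ => //; first exact/measurable_EFinP.
(* The constant is moved to the side of the measurable integrand [h']; the speed of the curve is
   then met only through monotonicity. *)
rewrite -lee_pdivrMl// -ge0_integralZl_EFin//; last 2 first.
- by apply: measurableT_comp => //; exact/measurable_EFinP.
- by rewrite invr_ge0 ltW.
apply: ge0_le_integral_nonmeasurable => t /=.
  by rewrite mule_ge0// lee_fin invr_ge0 ltW.
rewrite in_itv/= => tab; have [_ Dt _] := along t tab.
rewrite lee_pdivrMl// lee_fin /h' Dt.
apply: le_trans (cauchy_schwarz_inner _ _ _ _) _.
by apply: ler_wpM2r; rewrite ?sqrtr_ge0.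
Qed.

End SmoothAlongCurves.

(** * Lipschitz test functions *)

Lemma derive_bounded_lipschitz {R : realType} (F : R -> R) (t0 K : R) :
  (\forall t \near t0, derivable F t 1 /\ `|'D_1 F t| <= K) ->
  exists2 U, nbhs t0 U & forall s t, U s -> U t -> `|F s - F t| <= K * `|s - t|.
Proof.
move=> /nbhs_ballP[e /= e0 dF]; exists (ball t0 e); first exact: nbhsx_ballx.
suff lt_case s t : ball t0 e s -> ball t0 e t -> s < t -> `|F s - F t| <= K * `|s - t|.
  move=> s t Us Ut; have [st|ts|->] := ltgtP s t; first exact: lt_case.
    by rewrite distrC (distrC s); exact: lt_case.
  by rewrite !subrr normr0 mulr0.
rewrite -ball_normE/= => Us Ut st.
have inb r : s <= r <= t -> ball t0 e r.
  move=> /andP[sr rt]; rewrite -ball_normE/= ltr_norml.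
  move: Us Ut; rewrite !ltr_norml => /andP[_ h1] /andP[h2 _].
  by apply/andP; split; lra.
have [||r] := @MVT R F ('D_1 F) s t st.
- move=> r; rewrite in_itv/= => /andP[sr rt]; apply/derivableP.
  by have /dF[] : ball t0 e r by apply: inb; rewrite (ltW sr) (ltW rt).
- apply: continuous_in_subspaceT => r; rewrite inE/= in_itv/= => /inb/dF[dr _].
  by apply: differentiable_continuous; exact/derivable1_diffP.
rewrite in_itv/= => /andP[sr rt] FE.
rewrite distrC FE normrM (distrC s); apply: ler_wpM2r => //.
by have /dF[] : ball t0 e r by apply: inb; rewrite (ltW sr) (ltW rt).
Qed.

(** Away from 0 this is the usual power rule. At 0 the quotient has absolute value |h|^(p-1), which
    tends to 0 because p > 1, in agreement with [Num.sg 0 = 0]. *)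
Lemma is_derive_norm_powR {R : realType} (p t : R) : 1 < p ->
  is_derive t 1 (fun t => `|t| `^ p) (p * `|t| `^ (p - 1) * Num.sg t).
Proof.
move=> p1; have [t0|t0|->] := ltgtP t 0.
- apply: (@near_eq_is_derive _ _ _ (fun s => (- s) `^ p)).
    near=> s; rewrite ltr0_norm//; near: s.
    by apply: open_nbhs_nbhs; split => //; exact: open_lt.
  have Nt0 : 0 < - t by rewrite oppr_gt0.
  have dp := is_derive1_powR p Nt0.
  have dN : is_derive t 1 (fun s : R => - s) (- 1) by exact: is_deriveN.
  have := is_derive1_comp dp dN; by rewrite ltr0_norm// ltr0_sg//.
- apply: (@near_eq_is_derive _ _ _ (fun s => s `^ p)).
    near=> s; rewrite gtr0_norm//; near: s.
    by apply: open_nbhs_nbhs; split => //; exact: open_gt.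
  by rewrite gtr0_norm// gtr0_sg// mulr1; exact: is_derive1_powR.
- have q0 : 0 < p - 1 by rewrite subr_gt0.
  rewrite sgr0 mulr0.
  have h : (fun h : R => `|h| `^ p * h^-1) @ 0^' --> (0 : R).
    apply/cvgrPdist_lt => e e0; near=> h.
    rewrite sub0r normrN normrM normfV.
    have h0 : h != 0 by near: h; exact: nbhs_dnbhs_neq.
    have nh0 : 0 < `|h| by rewrite normr_gt0.
    rewrite (ger0_norm (powR_ge0 _ _)) -(powR_inv1 (ltW nh0)) -powRD; last first.
      by apply/implyP => _; rewrite gt_eqF.
    have -> : e = (e `^ (p - 1)^-1) `^ (p - 1).
      by rewrite -powRrM mulVf ?gt_eqF// powRr1// ltW.
    apply: gt0_ltr_powR => //; rewrite ?nnegrE ?powR_ge0//.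
    near: h; apply: dnbhs0_lt; exact: powR_gt0.
  have E : (fun h : R => `|h| `^ p * h^-1) = (fun h : R => h^-1 *:
      (((fun t : R => `|t| `^ p) \o shift 0) (h *: (1 : R^o)) - `|0 : R| `^ p)).
    apply/funext => k; rewrite /= addr0 normr0 powR0 ?gt_eqF ?(lt_trans _ p1)//.
    by rewrite subr0 /GRing.scale/= mulr1 mulrC.
  by rewrite E in h; split; [apply/cvg_ex; exists 0|exact/cvg_lim].
Unshelve. all: by end_near. Qed.

Lemma norm_powR_lipschitz {R : realType} (p t0 : R) : 1 < p ->
  exists K, \forall t \near t0, derivable (fun s : R => `|s| `^ p) (t : R) 1 /\
    `|'D_1 (fun s : R => `|s| `^ p) t| <= K.
Proof.
move=> p1; exists (p * (`|t0| + 1) `^ (p - 1)); near=> t.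
have [dt ->] := is_derive_norm_powR t p1; split => //.
have p0 : 0 < p by lra.
rewrite !normrM (gtr0_norm p0) (ger0_norm (powR_ge0 _ _)) -mulrA.
apply: ler_wpM2l; first exact: ltW.
apply: (@le_trans _ _ (`|t| `^ (p - 1))).
  apply: ler_piMr; first exact: powR_ge0.
  by rewrite normr_sg; case: (t != 0).
apply: ge0_ler_powR; rewrite ?nnegrE//; first by lra.
apply: ltW; near: t.
have : `|t| @[t --> t0] --> `|t0| by apply: cvg_norm; exact: cvg_id.
by move=> /cvgr_lt; apply; rewrite ltrDl.
Unshelve. all: by end_near. Qed.

Lemma powR_lipschitz {R : realType} (r t0 : R) : 0 < t0 ->
  exists K, \forall t \near t0, derivable (fun s : R => s `^ r) (t : R) 1 /\
    `|'D_1 (fun s : R => s `^ r) t| <= K.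
Proof.
move=> t00; exists (`|r * t0 `^ (r - 1)| + 1); near=> t.
have tp : 0 < t by near: t; apply: open_nbhs_nbhs; split => //; exact: open_gt.
have [dt ->] := is_derive1_powR r tp; split => //.
apply: ltW; near: t.
have : (fun t => `|r * t `^ (r - 1)|) @ t0 --> `|r * t0 `^ (r - 1)|.
  apply: cvg_norm; apply: cvgMl_tmp.
  apply: (@differentiable_continuous _ _ _ t0 (fun t => t `^ (r - 1))).
  by apply/derivable1_diffP; have [] := is_derive1_powR (r - 1) t00.
by move=> /cvgr_lt; apply; rewrite ltrDl.
Unshelve. all: by end_near. Qed.

Section LocallyLipschitz.
Context {R : realType} {n : nat} {M : @smooth_manifold R n}.
Variable g : riemannian_metric M.
Implicit Types (f h : M -> R) (x : M).

(** A condition at a single point: the power rho^(alpha+1) is Lipschitz only near points where [rho]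
    is positive. *)
Definition lipschitz_near f x := exists2 U : set M, nbhs x U & lipschitz_in g U f.

Lemma lipschitz_near_continuous f x : lipschitz_near f x -> {for x, continuous f}.
Proof. by move=> [U xU]; exact: lipschitz_in_continuous. Qed.

Lemma lipschitz_near_comp f (F : R -> R) K x : lipschitz_near f x ->
  (\forall t \near f x, derivable F t 1 /\ `|'D_1 F t| <= K) ->
  lipschitz_near (F \o f) x.
Proof.
move=> lf dF; have cf := lipschitz_near_continuous lf.
have [U xU [L L0 fL]] := lf.
have [W fxW FW] := derive_bounded_lipschitz dF.
have K0 : 0 <= K by have [_] := nbhs_singleton dF; exact: le_trans.
exists (U `&` f @^-1` W); first by apply: filterI => //; exact: cf.
(* The 1 makes the constant positive, as [lipschitz_in] demands, even when [K] is 0. *)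
exists (K * L + 1) => [|y z [Uy Wy] [Uz Wz]].
  by rewrite ltr_wpDl// mulr_ge0// ltW.
have d0 := riem_dist_ge0 g y z.
apply: (@le_trans _ _ (K%:E * (L%:E * riem_dist g y z))%E).
  apply: (@le_trans _ _ (K%:E * `|f y - f z|%:E)%E).
    by rewrite -EFinM lee_fin; exact: FW.
  by apply: lee_wpmul2l; [rewrite lee_fin|exact: fL].
rewrite muleA -EFinM; apply: lee_wpmul2r => //.
by rewrite lee_fin lerDl.
Qed.

Lemma lipschitz_near_mul f h x : lipschitz_near f x -> lipschitz_near h x ->
  lipschitz_near (fun x => f x * h x) x.
Proof.
move=> lf lh; have cf := lipschitz_near_continuous lf.
have ch := lipschitz_near_continuous lh.
have [U xU [L L0 fL]] := lf; have [U' xU' [L' L'0 hL']] := lh.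
pose A := `|f x| + 1; pose B := `|h x| + 1.
have A0 : 0 < A by rewrite ltr_wpDl.
have B0 : 0 < B by rewrite ltr_wpDl.
exists (U `&` U' `&` [set y | `|f y| < A] `&` [set y | `|h y| < B]).
  do 3 (try apply: filterI) => //.
    by apply: (cvgr_norm_lt _ cf); rewrite ltrDl.
  by apply: (cvgr_norm_lt _ ch); rewrite ltrDl.
exists (A * L' + B * L) => [|y z [[[Uy U'y] /= fy] hy] [[[Uz U'z] /= fz] hz]].
  by rewrite addr_gt0// mulr_gt0.
have d0 := riem_dist_ge0 g y z.
apply: (@le_trans _ _ (A%:E * (L'%:E * riem_dist g y z) +
                       B%:E * (L%:E * riem_dist g y z))%E); last first.
  by rewrite !muleA -!EFinM -ge0_muleDl// lee_fin mulr_ge0// ltW.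
apply: (@le_trans _ _ (A%:E * `|h y - h z|%:E + B%:E * `|f y - f z|%:E)%E).
  rewrite -!EFinM -EFinD lee_fin.
  rewrite (_ : f y * h y - f z * h z = f y * (h y - h z) + h z * (f y - f z)); last by ring.
  apply: le_trans (ler_normD _ _) _; rewrite !normrM.
  by apply: lerD; apply: ler_wpM2r => //; exact: ltW.
apply: leeD; apply: lee_wpmul2l; rewrite ?lee_fin ?(ltW A0) ?(ltW B0)//.
- exact: hL'.
- exact: fL.
Qed.

Lemma near_eq_lipschitz_near f h x : (\forall y \near x, f y = h y) ->
  lipschitz_near f x -> lipschitz_near h x.
Proof.
move=> fh [U xU [L L0 fL]]; exists (U `&` [set y | f y = h y]); first exact: filterI.
by exists L => // y z [Uy /= <-] [Uz /= <-]; exact: fL.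
Qed.

Lemma lipschitz_near_cst k x : lipschitz_near (cst k) x.
Proof.
exists setT; first exact: filterT.
by exists 1 => // y z _ _; rewrite subrr normr0 mul1e; exact: riem_dist_ge0.
Qed.

(** Compactness gives one constant valid near every point of the support, and off the support [f] is
    locally 0. The curve-cutting argument turns this uniform local bound into a global one. *)
Lemma lipschitz_compact_support f : (forall x, lipschitz_near f x) ->
  compact (support f) -> lipschitz_in g setT f.
Proof.
move=> lf cf.
pose P (S : set M) := exists2 L, 0 < L & forall x, S x ->
  exists2 U : set M, nbhs x U & forall y z, U y -> U z ->
     (`|f y - f z|%:E <= L%:E * riem_dist g y z)%E.
have Pmono L L' y z : L <= L' -> (`|f y - f z|%:E <= L%:E * riem_dist g y z)%E ->
    (`|f y - f z|%:E <= L'%:E * riem_dist g y z)%E.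
  move=> LL' h; apply: le_trans h _; apply: lee_wpmul2r; first exact: riem_dist_ge0.
  by rewrite lee_fin.
have [L L0 fL] : P (support f).
  apply: compact_ind => //.
  - by exists 1.
  - move=> A B [L L0 LA] [L' L'0 LB]; exists (Num.max L L'); first by rewrite lt_max L0.
    move=> x [/LA|/LB] [U xU fU]; exists U => // y z Uy Uz.
      by apply: Pmono (fU _ _ Uy Uz); rewrite le_max lexx.
    by apply: Pmono (fU _ _ Uy Uz); rewrite le_max lexx orbT.
  - by move=> A B AB [L L0 LB]; exists L => // x /AB; exact: LB.
  move=> x _; have [U xU [L L0 fU]] := lf x; exists U° => //; first exact: nbhs_interior.
  by exists L => // y Uy; exists U.
apply: (locally_lipschitz_curves L0) => x.
have [/fL//|sx] := pselect (support f x).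
exists (~` support f).
  apply: open_nbhs_nbhs; split => //.
  by apply: closed_openC; exact: closed_closure.
have f0 y : ~ support f y -> f y = 0.
  by move=> sy; apply: contrapT => /eqP fy; apply: sy; exact: subset_closure.
move=> y z /f0 -> /f0 ->; rewrite subrr normr0 mule_ge0 ?riem_dist_ge0//.
by rewrite lee_fin ltW.
Qed.

End LocallyLipschitz.

Section GradientRules.
Context {R : realType} {n : nat} {M : @smooth_manifold R n}.
Variable g : riemannian_metric M.
Implicit Types (f h : M -> R) (x : M).

Lemma differentiable_at_mul f h x : differentiable_at f x -> differentiable_at h x ->
  differentiable_at (fun x => f x * h x) x.
Proof. by move=> df dh; exact: differentiableM. Qed.

Lemma grad_mul f h x : differentiable_at f x -> differentiable_at h x ->
  grad g (fun x => f x * h x) x = f x *: grad g h x + h x *: grad g f x.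
Proof.
move=> df dh; rewrite !gradE 2!scalemxAl -mulmxDl; congr (_ *m _).
apply/rowP => i; rewrite !mxE.
have -> : (fun x => f x * h x) \o cinv (chart_at x) =
  (f \o cinv (chart_at x)) * (h \o cinv (chart_at x)) by [].
rewrite deriveM; [|exact: diff_derivable..].
by rewrite /= (cmapK (chart_at_dom x)).
Qed.

Lemma differentiable_at_comp f (F : R -> R) x : differentiable_at f x ->
  derivable F (f x) 1 -> differentiable_at (F \o f) x.
Proof.
move=> df dF; apply: (@differentiable_comp _ _ _ _ (f \o cinv (chart_at x)) F) => //.
by rewrite /= (cmapK (chart_at_dom x)); exact/derivable1_diffP.
Qed.

Lemma grad_comp f (F : R -> R) x : differentiable_at f x -> derivable F (f x) 1 ->
  grad g (F \o f) x = 'D_1 F (f x) *: grad g f x.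
Proof.
move=> df dF; rewrite !gradE scalemxAl; congr (_ *m _).
apply/rowP => i; rewrite !mxE.
have fx : (f \o cinv (chart_at x)) (cmap (chart_at x) x) = f x.
  by rewrite /= (cmapK (chart_at_dom x)).
have dF' : differentiable F ((f \o cinv (chart_at x)) (cmap (chart_at x) x)).
  by rewrite fx; exact/derivable1_diffP.
rewrite (_ : (F \o f) \o _ = F \o (f \o cinv (chart_at x)))//.
rewrite (deriveE _ (differentiable_comp df dF')) diff_comp//= -(deriveE _ df).
rewrite -[X in 'd F _ X]mulr1 [LHS]linearZ/= -(deriveE _ dF') mulrC.
by rewrite /= (cmapK (chart_at_dom x)).
Qed.

End GradientRules.

(** * Local finiteness of the volume *)

Section VolumeBounds.
Context {R : realType}.

Lemma integral_rV_ge0 m (f : 'rV[R]_m -> \bar R) :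
  (forall y, (0 <= f y)%E) -> (0 <= integral_rV f)%E.
Proof.
elim: m f => [|m IH] f f0 /=; first exact: f0.
by apply: integral_ge0 => t _; apply: IH.
Qed.

Lemma integral_rV_le m (f : 'rV[R]_m -> \bar R) (K r : R) : 0 <= K -> 0 <= r ->
  (forall y, (0 <= f y <= K%:E)%E) ->
  (forall (y : 'rV[R]_m) (i : 'I_m), r < `|y 0 i| -> f y = 0%E) ->
  (integral_rV f <= (K * (r *+ 2) ^+ m)%:E)%E.
Proof.
elim: m f K => [|m IH] f K K0 r0 fK fr /=.
  by rewrite expr0 mulr1; have /andP[] := fK 0.
have f0 y : (0 <= f y)%E by have /andP[] := fK y.
pose L := (K * (r *+ 2) ^+ m)%:E.
pose B : set R := [set` `[- r, r]].
apply: (@le_trans _ _ (\int[lebesgue_measure]_(t in B) cst L t)%E); last first.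
  rewrite integral_cst; last exact: measurable_itv.
  rewrite /= /B lebesgue_measure_itv/= lte_fin.
  case: ifPn => [_|_].
    by rewrite /L -EFinM lee_fin opprK exprSr mulrA.
  by rewrite mule0 lee_fin mulr_ge0// exprn_ge0// mulrn_wge0.
rewrite [leRHS]integral_mkcond; apply: ge0_le_integral_nonmeasurable => t _.
  exact: integral_rV_ge0.
rewrite /patch; case: ifPn => [_|]; first apply: IH => //.
- by move=> y i ri; rewrite -(row_mxEr (t%:M : 'rV[R]_1) y) in ri; exact: fr ri.
rewrite notin_setE /B/= in_itv/= => tB.
have tr : r < `|t| by rewrite ltNge ler_norml; apply/negP.
(* Outside [-r, r] the whole slice vanishes, so the induction hypothesis is used with bound 0. *)
rewrite -[leRHS](_ : (0 * (r *+ 2) ^+ m)%:E = 0%E); last by rewrite mul0r.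
have f_eq0 y : f (row_mx (t%:M : 'rV[R]_1) y) = 0%E.
  have tE : (row_mx (t%:M : 'rV[R]_1) y) 0 (lshift m 0) = t.
    by rewrite row_mxEl mxE eqxx mulr1n.
  by rewrite -tE in tr; exact: fr tr.
by apply: IH => // y; rewrite f_eq0 lexx.
Qed.

Context {n : nat} {M : @smooth_manifold R n}.
Variables (g : riemannian_metric M) (vol : {measure set (borel M) -> \bar R}).
Hypothesis volP : is_riemannian_volume g vol.

(** On a small coordinate ball the determinant of the metric is bounded, so the chart integral is at
    most a constant times the volume of a cube containing the ball. *)
Lemma vol_locally_finite (x : M) : exists U : set M,
  [/\ open U, U x & (vol U < +oo)%E].
Proof.
pose c := chart_at x; have ac : atlas c := chart_at_atlas x.
have cx : cdom c x := chart_at_dom x.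
pose y0 := cmap c x; pose d y := \det (form_in_chart g c y).
have cd : {for y0, continuous d}.
  apply: (@cvg_det _ _ (nbhs y0) (nbhs_filter y0)) => i j.
  have := metric_smooth g ac 0 _ (cmap_fun cx) => cform.
  by apply: (@continuous_comp _ _ _ (form_in_chart g c) (fun A : 'M[R]_n => A i j)) => //;
    exact: coord_continuous.
have : \forall y \near y0, d y < d y0 + 1.
  by apply: (cvgr_lt _ cd); rewrite ltrDl.
move=> /nbhs_ballP[e /= e0 de].
pose U := cdom c `&` cmap c @^-1` ball y0 e.
have oU : open U.
  rewrite openE => z [cz Bz]; apply: filterI; first exact: near_chart_dom.
  apply: (cmap_continuous cz); apply: open_nbhs_nbhs; split => //.
  exact: ball_open.
exists U; split => //; first by split => //; exact: ballxx.
rewrite (volP ac); last 2 first.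
- exact: sub_sigma_algebra.
- by move=> z [].
pose K := Num.sqrt `|d y0 + 1|.
apply: (@le_lt_trans _ _ (K * ((`|y0| + e) *+ 2) ^+ n)%:E); last exact: ltry.
have r0 : 0 <= `|y0| + e by rewrite addr_ge0// ltW.
apply: integral_rV_le => //; first exact: sqrtr_ge0.
  move=> y; rewrite !lee_fin mulr_ge0 ?sqrtr_ge0//=.
  rewrite indicE; case: (boolP (y \in _)) => [|_]; last by rewrite mul0r sqrtr_ge0.
  rewrite inE => -[cy [_ /= By]]; rewrite mul1r; apply: ler_wsqrtr.
  rewrite cinvK// in By; apply: le_trans (ler_norm _).
  exact: (ltW (de _ By)).
move=> y i yi; rewrite indicE memNset ?mul0r//.
move=> [cy [_ /= By]]; rewrite cinvK// in By.
move: yi; apply/negP; rewrite -leNgt; apply: le_trans (ler_coord_norm _ _ _) _.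
rewrite -(subrKC y0 y); apply: le_trans (ler_normD _ _) _.
apply: lerD => //; rewrite distrC.
by move: By; rewrite -ball_normE/= => /ltW.
Qed.

Lemma vol_compact_finite (K : set M) : compact K -> measurable (K : set (borel M)) ->
  (vol K < +oo)%E.
Proof.
move=> cK mK; pose P (S : set M) := exists U : set (borel M),
  [/\ measurable U, S `<=` U & (vol U < +oo)%E].
suff [U [mU KU fU]] : P K.
  by apply: le_lt_trans fU; apply: le_measure; rewrite ?inE.
apply: compact_ind => //.
- by exists set0; split => //; rewrite measure0.
- move=> A B [U [mU AU fU]] [W [mW BW fW]]; exists (U `|` W); split.
  + exact: measurableU.
  + exact: setUSS.
  + by apply: le_lt_trans (measureU2 _ mU mW) _; rewrite lte_add_pinfty.
- by move=> A B AB [U [mU BU fU]]; exists U; split => //; exact: subset_trans BU.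
move=> x _; have [U [oU Ux fU]] := vol_locally_finite x.
exists U; first exact: open_nbhs_nbhs.
by exists U; split => //; exact: sub_sigma_algebra.
Qed.

End VolumeBounds.

(** * The inequality *)

Section IntegralArgument.
Context d (T : measurableType d) (R : realType) (mu : {measure set T -> \bar R}).
Variables (E : set T) (mE : measurable E).
Implicit Types (A B S L J : T -> R).
Local Notation int f := (\int[mu]_(x in E) (f x)%:E)%E.

(** The negative part of B + J is at most |J|, so its integral is finite and a signed integral below
    +oo forces a finite positive part. Then B <= (B + J)^+ + |J| concludes. *)
Lemma integrable_of_integral_lty B J : measurable_fun E B ->
  (forall x, E x -> 0 <= B x) -> mu.-integrable E (EFin \o J) ->
  (int (fun x => B x + J x)%R < +oo)%E -> mu.-integrable E (EFin \o B).
Proof.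
move=> mB B0 iJ; pose H x := (B x + J x)%:E.
have mJ : measurable_fun E J by move/integrableP: iJ => [/measurable_EFinP].
have mH : measurable_fun E H by apply/measurable_EFinP; exact: measurable_funD.
have ilJ : (\int[mu]_(x in E) `|(J x)%:E| < +oo)%E by move/integrableP: iJ => [].
have Hneg : (\int[mu]_(x in E) H^\- x < +oo)%E.
  apply: le_lt_trans ilJ; apply: ge0_le_integral_nonmeasurable => x Ex.
    exact: funeneg_ge0.
  rewrite funenegE /H ge_max abse_ge0 andbT -EFinN lee_fin.
  by have := B0 x Ex; have := ler_norm (- J x); rewrite normrN; lra.
rewrite integralE -/(H^\+)%E => Hlt.
have Hpos : (\int[mu]_(x in E) H^\+ x < +oo)%E.
  rewrite ltNge leye_eq; apply/negP => /eqP Hy; move: Hlt.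
  have Hfin : (\int[mu]_(x in E) H^\- x)%E \is a fin_num.
    by rewrite ge0_fin_numE//; apply: integral_ge0 => x _; exact: funeneg_ge0.
  by rewrite Hy -(fineK Hfin).
apply/integrableP; split; first exact/measurable_EFinP.
apply: (@le_lt_trans _ _ (\int[mu]_(x in E) (H^\+ x + `|(J x)%:E|))%E).
  apply: ge0_le_integral_nonmeasurable => // x Ex.
  rewrite /= funeposE /H -EFin_max -EFinD lee_fin ger0_norm ?B0//.
  have : B x + J x <= Num.max (B x + J x) 0 by rewrite le_max lexx.
  have := ler_norm (- J x); rewrite normrN.
  by move: (Num.max _ _) (`|J x|) => m j; lra.
rewrite ge0_integralD//; first exact: lte_add_pinfty.
- exact: measurable_funepos.
- by apply: measurableT_comp => //; exact/measurable_EFinP.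
Qed.

(** Multiplying the weak inequality by [c] gives c(C + e) int A + c int B <= -c int S <= k1 int A +
    int L. The work is in justifying linearity: [S] is dominated by (k1 A + L)/c, and [B] becomes
    integrable through the weak inequality. *)
Lemma integral_young A B S L (C e c k1 k2 : R) :
  (forall x, E x -> 0 <= A x) -> (forall x, E x -> 0 <= B x) ->
  (forall x, E x -> 0 <= L x) ->
  mu.-integrable E (EFin \o A) -> measurable_fun E B -> measurable_fun E S ->
  measurable_fun E L ->
  (forall x, E x -> c * `|S x| <= k1 * A x + L x) ->
  (C%:E * int A <= - int (fun x => e * A x + B x + S x)%R)%E ->
  0 < c -> 0 <= k1 -> c * C + c * e - k1 = k2 ->
  (k2%:E * int A + c%:E * int B <= int L)%E.
Proof.
move=> A0 B0 L0 iA mB mS mL SAL CH c0 k10 ck.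
have [->|Ly] := eqVneq (int L) +oo%E; first by rewrite leey.
have iL : mu.-integrable E (EFin \o L).
  apply/integrableP; split; first exact/measurable_EFinP.
  rewrite (_ : (\int[mu]_(x in E) _)%E = int L) ?ltey//.
  by apply: eq_integral => x /set_mem Ex; rewrite /= ger0_norm// L0.
have iZ k f : mu.-integrable E (EFin \o f) -> mu.-integrable E (EFin \o (fun x => k * f x)).
  by move=> fi; have := integrableZl mE k fi.
have iD f h : mu.-integrable E (EFin \o f) -> mu.-integrable E (EFin \o h) ->
    mu.-integrable E (EFin \o (fun x => f x + h x)).
  by move=> fi hi; have := integrableD mE fi hi.
have iS : mu.-integrable E (EFin \o S).
  apply: (le_integrable mE) (iZ c^-1 _ (iD _ _ (iZ k1 _ iA) iL)); first exact/measurable_EFinP.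
  move=> x Ex; rewrite /= lee_fin normrM gtr0_norm ?invr_gt0//.
  rewrite ler_pdivlMl//; apply: le_trans (SAL x Ex) _; exact: ler_norm.
pose J x := e * A x + S x.
have iJ : mu.-integrable E (EFin \o J) by apply: iD => //; exact: iZ.
have HE : (int (fun x => e * A x + B x + S x)%R = int (fun x => B x + J x)%R).
  by apply: eq_integral => x _; congr (_%:E); rewrite /J; ring.
have Afin := integrable_fin_num mE iA.
have iB : mu.-integrable E (EFin \o B).
  apply: (integrable_of_integral_lty mB B0 iJ); rewrite -HE.
  (* An integral equal to +oo would make the right side of the weak inequality -oo, below a finite
     left side. *)
  rewrite ltNge leye_eq; apply/negP => /eqP Hy; move: CH.
  by rewrite Hy -(fineK Afin).
have intZ k f : mu.-integrable E (EFin \o f) -> (int (fun x => k * f x)%R = k%:E * int f)%E.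
  by move=> fi; rewrite -integralZl.
have intD f h : mu.-integrable E (EFin \o f) -> mu.-integrable E (EFin \o h) ->
    (int (fun x => f x + h x)%R = int f + int h)%E.
  by move=> fi hi; rewrite -integralD.
rewrite HE (intD _ _ iB iJ) (intD _ _ (iZ e _ iA) iS) (intZ _ _ iA) in CH.
have : (int (fun x => - c * S x)%R <= int (fun x => k1 * A x + L x)%R)%E.
  apply: le_integral => //; first exact: iZ.
    by apply: iD => //; exact: iZ.
  move=> x /set_mem Ex; rewrite lee_fin; apply: le_trans (SAL x Ex).
  by rewrite mulNr -mulrN ler_wpM2l ?(ltW c0)// -normrN ler_norm.
rewrite (intZ _ _ iS) (intD _ _ (iZ k1 _ iA) iL) (intZ _ _ iA).
move: CH; have Bfin := integrable_fin_num mE iB; have Sfin := integrable_fin_num mE iS.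
have Lfin := integrable_fin_num mE iL.
rewrite -(fineK Afin) -(fineK Bfin) -(fineK Sfin) -(fineK Lfin).
move: (fine _) (fine _) (fine _) (fine _) => a b s l.
rewrite -!EFinM -!EFinD -EFinN !lee_fin -ck => h1 h2.
have := ler_wpM2l (ltW c0) h1; nra.
Qed.

End IntegralArgument.

(** Young's inequality for (K y)^(p-1) and z with conjugate exponents p/(p-1) and p, multiplied by
    p. *)
Lemma young_powR {R : realType} (p K y z : R) : 1 < p -> 0 <= K -> 0 <= y -> 0 <= z ->
  p * (K `^ (p - 1) * y `^ (p - 1)) * z <= (p - 1) * (K `^ p * y `^ p) + z `^ p.
Proof.
move=> p1 K0 y0 z0; have p0 : 0 < p by lra.
have q0 : 0 < p / (p - 1) by rewrite divr_gt0// subr_gt0.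
rewrite -!powRM//.
have pq : (p / (p - 1))^-1 + p^-1 = 1 by rewrite invf_div; field; lra.
have := conjugate_powR (powR_ge0 (K * y) (p - 1)) z0 q0 p0 pq.
rewrite -powRrM (_ : (p - 1) * (p / (p - 1)) = p); last by field; lra.
rewrite -(ler_pM2l p0) mulrA => h; apply: le_trans h _.
rewrite le_eqVlt; apply/orP; left; apply/eqP; field; lra.
Qed.

Section HardyTestFunction.
Context {R : realType} {n : nat} {M : @smooth_manifold R n}.
Variable g : riemannian_metric M.
Variables (rho a phi : M -> R) (alpha p : R).
Hypotheses (p1 : 1 < p) (sphi : smooth_fun phi).

Definition hardy_test (x : M) : R :=
  a x * (rho x `^ (alpha + 1) * `|phi x| `^ p).

Let p0 : 0 < p. Proof. exact: lt_trans p1. Qed.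

Lemma hardy_test_eq0 x : phi x = 0 -> hardy_test x = 0.
Proof. by move=> px; rewrite /hardy_test px normr0 powR0 ?gt_eqF// !mulr0. Qed.

Lemma support_hardy_test : support hardy_test `<=` support phi.
Proof.
apply: closure_subset => x /=; apply: contra_neq; exact: hardy_test_eq0.
Qed.

Lemma compact_support_hardy_test : compact (support phi) -> compact (support hardy_test).
Proof.
move=> cphi; apply: (subclosed_compact _ cphi support_hardy_test).
exact: closed_closure.
Qed.

Lemma hardy_test_lipschitz : locally_lipschitz g rho -> locally_lipschitz g a ->
  compact (support phi) -> (forall x, support phi x -> 0 < rho x) ->
  lipschitz_in g setT hardy_test.
Proof.
move=> lrho la cphi rho0.
apply: lipschitz_compact_support; last exact: compact_support_hardy_test.
(* Off the support [rho] may vanish and its power need not be Lipschitz, but there the product is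
   locally 0. On the support [rho] is positive, so any real exponent is allowed. *)
move=> x; have [sx|sx] := pselect (support phi x); last first.
  apply: (@near_eq_lipschitz_near _ _ _ _ (cst 0)); last exact: lipschitz_near_cst.
  have : \forall y \near x, ~ support phi y.
    apply: open_nbhs_nbhs; split => //.
    by apply: closed_openC; exact: closed_closure.
  apply: filterS => y sy; rewrite hardy_test_eq0//.
  by apply: contrapT => /eqP py; apply: sy; exact: subset_closure.
apply: lipschitz_near_mul; first exact: la.
apply: lipschitz_near_mul.
  have [K HK] := powR_lipschitz (alpha + 1) (rho0 x sx).
  exact: (lipschitz_near_comp (lrho x) HK).
have [K HK] := norm_powR_lipschitz (phi x) p1.
have lphi : lipschitz_near g phi x.
  by exists setT; [exact: filterT|exact: smooth_lipschitz].
exact: (lipschitz_near_comp lphi HK).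
Qed.

Lemma grad_hardy_test x : 0 < rho x -> differentiable_at rho x ->
  differentiable_at a x ->
  grad g hardy_test x =
    a x *: (rho x `^ (alpha + 1) *:
              (p * `|phi x| `^ (p - 1) * Num.sg (phi x) *: grad g phi x) +
            `|phi x| `^ p *: ((alpha + 1) * rho x `^ alpha *: grad g rho x)) +
    (rho x `^ (alpha + 1) * `|phi x| `^ p) *: grad g a x.
Proof.
move=> rx drho da.
have [dr Dr] := is_derive1_powR (alpha + 1) rx.
have [df Df] := is_derive_norm_powR (phi x) p1.
have dphi := smooth_differentiable x sphi.
have drc := differentiable_at_comp drho dr.
have dfc := differentiable_at_comp dphi df.
rewrite (grad_mul g da (differentiable_at_mul drc dfc)) (grad_mul g drc dfc).
rewrite (grad_comp g drho dr) (grad_comp g dphi df) Dr Df.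
by rewrite [alpha + 1 - 1]addrK.
Qed.

(** Splitting V^tau as V^(tau+lam-mu) V^(mu-lam) supplies the factor that turns each plain gradient
    into an affine one. The unit length of nablaD rho then reduces the term from rho^(alpha+1) to
    alpha + 1 times the integrand A. *)
Lemma hardy_test_inner u lam mu x : 0 < rho x -> differentiable_at rho x ->
  differentiable_at a x -> tnorm g x (agrad g u lam mu rho x) = 1 ->
  let V := Vfun u in let t := tau n lam mu in
  let nablaD := agrad g u lam mu in
  inner g x (grad g hardy_test x) (nablaD rho x) * V x `^ t =
  (alpha + 1) * (a x * rho x `^ alpha * `|phi x| `^ p * V x `^ (t + lam - mu)) +
  rho x `^ (alpha + 1) * `|phi x| `^ p * inner g x (nablaD rho x) (nablaD a x) *
    V x `^ (t + lam - mu) +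
  p * (a x * rho x `^ (alpha + 1) * (`|phi x| `^ (p - 1) * Num.sg (phi x)) *
    inner g x (nablaD rho x) (nablaD phi x) * V x `^ (t + lam - mu)).
Proof.
move=> rx drho da nrho V t nablaD.
have Vx : 0 < V x by exact: expR_gt0.
have N1 : inner g x (nablaD rho x) (nablaD rho x) = 1.
  by rewrite -[LHS]sqr_sqrtr ?inner_ge0// -/(tnorm g x _) nrho expr1n.
rewrite grad_hardy_test//.
rewrite !(innerDl, innerZl).
move: N1; rewrite /nablaD /agrad !(innerZl, innerZr) -/V.
rewrite (inner_sym g x (grad g phi x)) (inner_sym g x (grad g a x)).
have -> : V x `^ t = V x `^ (t + lam - mu) * V x `^ (mu - lam).
  by rewrite -powRD ?(gt_eqF Vx) ?implybT//; congr (_ `^ _); ring.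
move: (V x `^ _) (V x `^ _) => w k.
move: (inner _ _ _ _) (inner _ _ _ _) (inner _ _ _ _) => N T B N1.
ring: N1.
Qed.

End HardyTestFunction.

Lemma compact_continuous_bounded {R : realType} (T : topologicalType) (K : set T)
    (f : T -> R) : compact K -> (forall x, K x -> {for x, continuous f}) ->
  exists b, forall x, K x -> `|f x| <= b.
Proof.
move=> cK cf.
apply: (compact_ind (P := fun S => exists b, forall x, S x -> `|f x| <= b)) => //.
- by exists 0.
- move=> A B [b Ab] [b' Bb']; exists (Num.max b b') => x [/Ab|/Bb'] h.
    by rewrite le_max h.
  by rewrite le_max h orbT.
- by move=> A B AB [b Bb]; exists b => x /AB; exact: Bb.
move=> x Kx; exists [set y | `|f y| <= `|f x| + 1]; last by exists (`|f x| + 1).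
by apply: (cvgr_norm_le _ (cf x Kx)); rewrite ltrDl.
Qed.

(** Applies to any [f], measurable or not, so integrals from the hypotheses can be moved to the good
    set before measurability is known. *)
Lemma integral_null_support d (T : measurableType d) (R : realType)
    (mu : {measure set T -> \bar R}) (N K : set T) (f : T -> \bar R) :
  measurable N -> mu N = 0%E -> (forall x, ~ K x -> f x = 0%E) ->
  (\int[mu]_x f x = \int[mu]_(x in ~` N `&` K) f x)%E.
Proof.
move=> mN N0 fK; rewrite (integral_setD_null setT f mN N0) setTD.
rewrite integral_mkcond [RHS]integral_mkcond; apply: eq_integral => x _.
rewrite /patch; have [Kx|Kx] := pselect (K x).
  by congr (if _ then _ else _); apply/idP/idP; rewrite !inE => // -[].
by rewrite fK// !if_same.
Qed.

Theorem theorem5p2 (R : realType) (n : nat) (M : @smooth_manifold R n)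
    (g : riemannian_metric M) (vol : {measure set (borel M) -> \bar R})
    (u : M -> R) (lam mu : R) (rho a : M -> R) (C alpha : R) :
  is_riemannian_volume g vol ->
  riem_complete g -> ~ compact [set: M] ->
  smooth_fun u ->
  (forall x, 0 <= rho x) -> (forall x, 0 <= a x) ->
  unit_agrad g vol u lam mu rho ->
  alaplacian_ge g vol u lam mu rho C ->
  agrad_inner_ge0 g vol u lam mu rho a ->
  1 < C -> 0 < C + alpha + 1 ->
  forall (phi : M -> R) (p : R),
  smooth_fun phi -> compactly_supported_in phi (~` (rho @^-1` [set 0])) ->
  1 < p ->
  let V := Vfun u in
  let t := tau n lam mu in
  let nablaD := agrad g u lam mu in
  (\int[vol]_x (a x * rho x `^ (alpha + p) *
                `|inner g x (nablaD rho x) (nablaD phi x)| `^ p *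
                V x `^ (t + lam - mu))%:E
   >= (((C + alpha + 1) / p) `^ p)%:E *
        \int[vol]_x (a x * rho x `^ alpha * `|phi x| `^ p *
                     V x `^ (t + lam - mu))%:E +
      (((C + alpha + 1) / p) `^ (p - 1))%:E *
        \int[vol]_x (rho x `^ (alpha + 1) * `|phi x| `^ p *
                     inner g x (nablaD rho x) (nablaD a x) *
                     V x `^ (t + lam - mu))%:E)%E.
Proof.
move=> volP _ _ su rho0 a0 [lrho aerho] lap [la aea] C1 C0 phi p sphi [cphi phirho] p1.
cbv zeta; set V := Vfun u; set t := tau n lam mu; set nablaD := agrad g u lam mu.
have p0 : 0 < p by exact: lt_trans p1.
have rhopos x : support phi x -> 0 < rho x.
  by move=> /phirho/eqP rx; rewrite lt_neqAle rho0 andbT eq_sym.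
have phi0 x : ~ support phi x -> phi x = 0.
  by move=> sx; apply: contrapT => /eqP px; apply: sx; exact: subset_closure.
have powphi0 x : ~ support phi x -> `|phi x| `^ p = 0.
  by move=> sx; rewrite phi0// normr0 powR0 ?gt_eqF.
have crho := locally_lipschitz_continuous lrho.
have ca := locally_lipschitz_continuous la.
have cu := smooth_continuous su.
have cph := smooth_continuous sphi.
(* One measurable null set contains all points where differentiability, the unit length or the sign
   condition fails. *)
have [N [mN N0 Nsub]] : {ae vol, forall x : borel M, [/\ differentiable_at rho x,
    differentiable_at a x, tnorm g x (nablaD rho x) = 1 &
    0 <= inner g x (nablaD rho x) (nablaD a x)]}.
  by apply: filterS2 aerho aea => x [dr nr] [_ da ra].
have NP x : ~ N x -> [/\ differentiable_at rho x, differentiable_at a x,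
    tnorm g x (nablaD rho x) = 1 & 0 <= inner g x (nablaD rho x) (nablaD a x)].
  by move=> Nx; apply: contrapT => /Nsub.
pose E : set (borel M) := ~` N `&` support phi.
have mS : measurable (support phi : set (borel M)).
  rewrite -(setCK (support phi)); apply: measurableC; apply: sub_sigma_algebra.
  by apply: closed_openC; exact: closed_closure.
have mE : measurable E by apply: measurableI => //; exact: measurableC.
pose Sphi : set (borel M) := support phi.
pose psi := hardy_test rho a phi alpha p.
pose W x := V x `^ (t + lam - mu).
have W0 x : 0 <= W x by exact: powR_ge0.
pose A x := a x * rho x `^ alpha * `|phi x| `^ p * W x.
pose B x := rho x `^ (alpha + 1) * `|phi x| `^ p *
  inner g x (nablaD rho x) (nablaD a x) * W x.
pose T x := inner g x (nablaD rho x) (nablaD phi x).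
pose L x := a x * rho x `^ (alpha + p) * `|T x| `^ p * W x.
pose S x := p * (a x * rho x `^ (alpha + 1) * (`|phi x| `^ (p - 1) * Num.sg (phi x)) *
  T x * W x).
have A0 x : 0 <= A x by rewrite !mulr_ge0 ?powR_ge0.
have L0 x : 0 <= L x by rewrite !mulr_ge0 ?powR_ge0.
have T0 x : ~ support phi x -> T x = 0.
  by move=> sx; rewrite /T /nablaD {2}/agrad (grad_support g sx) scaler0 /inner trmx0 mulmx0 mxE.
have {}lap := lap psi.
have psi0 x : 0 <= psi x by rewrite !mulr_ge0 ?powR_ge0.
have psiE x : ~ support phi x -> psi x = 0 by move=> /phi0; exact: hardy_test_eq0.
have {}lap := lap psi0 (hardy_test_lipschitz alpha p1 sphi lrho la cphi rhopos).
have spsi := @support_hardy_test _ _ _ rho a phi alpha p p1.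
have {}lap := lap (conj (@compact_support_hardy_test _ _ _ rho a phi alpha p p1 cphi)
  (subset_trans spsi phirho)).
(* Both integrals of the weak inequality and the three of the conclusion are moved to [E]; each
   integrand vanishes off the support of [phi]. *)
rewrite (integral_null_support mN N0 (K := Sphi)) in lap; last first.
  by move=> x sx; rewrite psiE// mulr0 mul0r.
rewrite [X in (_ <= - X)%E](integral_null_support mN N0 (K := Sphi)) in lap; last first.
  move=> x sx; rewrite grad_support ?/inner ?mul0mx ?mxE ?mul0r//.
  by move=> /spsi.
rewrite (integral_null_support mN N0 (K := Sphi)); last first.
  by move=> x sx; rewrite powphi0// mulr0 mul0r.
rewrite [X in (_ + _ * X)%E](integral_null_support mN N0 (K := Sphi)); last first.
  by move=> x sx; rewrite powphi0// mulr0 !mul0r.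
rewrite [leRHS](integral_null_support mN N0 (K := Sphi)); last first.
  by move=> x sx; rewrite -/(T x) T0// normr0 powR0 ?gt_eqF// mulr0 mul0r.
have Erho x : E x -> 0 < rho x by move=> [_ /rhopos].
have powR_cont r s : 0 < s -> {for s, continuous (fun s : R => s `^ r)}.
  move=> s0; apply: differentiable_continuous; apply/derivable1_diffP.
  by have [] := is_derive1_powR r s0.
have W_cont x : {for x, continuous W}.
  apply: (@continuous_comp _ _ _ V (fun s : R => s `^ (t + lam - mu))).
    by apply: (@continuous_comp _ _ _ u expR); [exact: cu|exact: continuous_expR].
  by apply: powR_cont; exact: expR_gt0.
have mcont (f : M -> R) : continuous f -> measurable_fun E (f : borel M -> R).
  move=> cf; have h : measurable_fun (setT : set (borel M)) (f : borel M -> R).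
    by apply: (measurable_continuous_open openT) => x _; exact: cf.
  by apply: measurable_funS h => //.
have mpow (f : borel M -> R) r : measurable_fun E f -> measurable_fun E (fun x => f x `^ r).
  by move=> mf; apply: (measurableT_comp (measurable_powR r)).
have mW := mcont W W_cont.
have mrho := mcont rho crho.
have ma := mcont a ca.
have mphi := mcont phi cph.
have mnphi : measurable_fun E (fun x : borel M => `|phi x|).
  by apply: (measurableT_comp _ mphi); exact: normr_measurable.
have mA : measurable_fun E (A : borel M -> R).
  apply: measurable_funM => //; apply: measurable_funM; last exact: mpow.
  by apply: measurable_funM => //; exact: mpow.
have minner (f : M -> R) : continuous f -> (forall x, ~ N x -> differentiable_at f x) ->
    measurable_fun E (fun x : borel M => inner g x (nablaD rho x) (nablaD f x)).
  move=> cf df.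
  have V_cont r : measurable_fun E (fun x : borel M => V x `^ r).
    apply: mpow; apply: (measurableT_comp (@measurable_expR R)); exact: mcont.
  apply: (eq_measurable_fun (fun x : borel M => V x `^ (mu - lam) * (V x `^ (mu - lam) *
     inner g x (grad g rho x) (grad g f x)))).
    by move=> x _; rewrite /nablaD /agrad innerZl innerZr.
  do 2 apply: measurable_funM => //.
  apply: measurable_inner_grad => //; first exact: measurableC.
  by move=> x Nx; split; [have [] := NP x Nx|exact: df].
have mT : measurable_fun E (T : borel M -> R).
  by apply: minner => // x _; exact: smooth_differentiable.
have mB : measurable_fun E (B : borel M -> R).
  apply: measurable_funM => //; apply: measurable_funM.
    by apply: measurable_funM; exact: mpow.
  by apply: minner => // x Nx; have [] := NP x Nx.
have mL : measurable_fun E (L : borel M -> R).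
  apply: measurable_funM => //; apply: measurable_funM.
    by apply: measurable_funM => //; exact: mpow.
  by apply: mpow; apply: (measurableT_comp _ mT); exact: normr_measurable.
have msg : measurable_fun E (fun x : borel M => Num.sg (phi x)).
  apply: (measurableT_comp _ mphi); apply: nondecreasing_measurable => // r s.
  by move=> rs; case: (sgrP r) => hr; case: (sgrP s) => hs; lra.
have mS' : measurable_fun E (S : borel M -> R).
  apply: (@measurable_funM _ _ _ _ (fun=> p)); first exact: measurable_cst.
  apply: measurable_funM; last exact: mW.
  apply: measurable_funM; last exact: mT.
  apply: measurable_funM; first by apply: measurable_funM; [exact: ma|exact: mpow].
  by apply: measurable_funM; [exact: mpow|exact: msg].
(* [A] is continuous at points of the support, where [rho] is positive, hence bounded on this
   compact set, which has finite volume. *)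
have iA : vol.-integrable E (EFin \o A).
  apply: measurable_bounded_integrable => //.
    apply: le_lt_trans (vol_compact_finite volP cphi mS).
    by apply: le_measure; rewrite ?inE// => x [].
  have [x sx|b Ab] := @compact_continuous_bounded _ _ _ A cphi.
    apply: cvgM; last exact: W_cont.
    apply: cvgM.
      apply: cvgM; first exact: ca.
      apply: (@continuous_comp _ _ _ rho (fun s : R => s `^ alpha)); first exact: crho.
      exact: powR_cont (rhopos x sx).
    apply: (@continuous_comp _ _ _ phi (fun s : R => `|s| `^ p)); first exact: cph.
    apply: differentiable_continuous; apply/derivable1_diffP.
    by have [] := is_derive_norm_powR (phi x) p1.
  exists b; split; first exact: num_real.
  by move=> m bm x [_ sx]; apply: le_trans (Ab x sx) (ltW bm).
pose K := (C + alpha + 1) / p.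
have K0 : 0 < K by rewrite divr_gt0.
have HK : K `^ p = K * K `^ (p - 1).
  rewrite -[X in X * _](powRr1 (ltW K0)) -powRD; last by rewrite (gt_eqF K0) implybT.
  by rewrite addrC subrK.
apply: (integral_young (C := C) (e := alpha + 1) (S := S) (k1 := (p - 1) * K `^ p) mE) => //.
- by move=> x _; exact: A0.
- move=> x Ex; have [_ _ _ h] := NP x Ex.1.
  apply: mulr_ge0; last exact: W0.
  by apply: mulr_ge0 => //; exact: mulr_ge0 (powR_ge0 _ _) (powR_ge0 _ _).
- by move=> x _; exact: L0.
- move=> x Ex; have rx := Erho x Ex.
  rewrite -/(T x) -/(W x) -/K.
  have rD s : rho x `^ (alpha + s) = rho x `^ alpha * rho x `^ s.
    by rewrite powRD// (gt_eqF rx) implybT.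
  (* Young is used with y = |phi| and z = rho |T|, then weighted by a rho^alpha W, so that rho^alpha
     rho^p gives the exponent of [L]. *)
  have := young_powR p1 (ltW K0) (normr_ge0 (phi x)) (mulr_ge0 (ltW rx) (normr_ge0 (T x))).
  rewrite (powRM _ (ltW rx) (normr_ge0 _)) => yng.
  have w0 : 0 <= a x * rho x `^ alpha * W x by rewrite !mulr_ge0 ?powR_ge0.
  apply: le_trans (le_trans (ler_wpM2l w0 yng) _); last first.
    by rewrite rD le_eqVlt; apply/orP; left; apply/eqP; ring.
  rewrite /S !normrM (ger0_norm (a0 x)) (ger0_norm (W0 x)) !(ger0_norm (powR_ge0 _ _)).
  rewrite (gtr0_norm p0) rD (powRr1 (ltW rx)).
  have sg1 : `|Num.sg (phi x)| <= 1 by rewrite normr_sg; case: (phi x != 0).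
  have nn : 0 <= p * (K `^ (p - 1) * `|phi x| `^ (p - 1)) * (rho x * `|T x|) *
      (a x * rho x `^ alpha * W x).
    by rewrite !mulr_ge0 ?powR_ge0 ?(ltW p0) ?(ltW rx).
  apply: le_trans (le_trans (ler_piMr nn sg1) _);
    by rewrite le_eqVlt; apply/orP; left; apply/eqP; ring.
(* On [E] the factor 1/rho lowers rho^(alpha+1) to rho^alpha, so the left side of the weak
   inequality is C int A; its right side is expanded by [hardy_test_inner]. *)
- rewrite -(integralZl mE iA).
  move: lap; congr (is_true (_ <= - _)%E).
    apply: eq_integral => x /set_mem Ex; rewrite -EFinM; congr (_%:E).
    have rx := Erho x Ex.
    rewrite /psi /hardy_test powRD ?(gt_eqF rx) ?implybT// (powRr1 (ltW rx)).
    by rewrite /A /W; field; rewrite gt_eqF.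
  apply: eq_integral => x /set_mem Ex; congr (_%:E).
  have [dr da nr _] := NP x Ex.1.
  exact: hardy_test_inner (Erho x Ex) dr da nr.
- exact: powR_gt0.
- by rewrite mulr_ge0 ?powR_ge0// subr_ge0 ltW.
(* Since C + alpha + 1 = p K, the coefficient is p K^p - (p-1) K^p = K^p. *)
- rewrite HK -/K (_ : C = K * p - alpha - 1); first by ring.
  by rewrite /K; field; rewrite gt_eqF.
Qed.
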